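(* Let $(\alpha_0,\beta_0)\in[0,1)\times(1,\infty)$ and let $\underline u=\underline u^{\alpha_0,\beta_0}=u_0u_1u_2\dots$ be the coding of $0$ under $T_{\alpha_0,\beta_0}$. Set $$\alpha(\beta):=(\beta-1)\sum_{j\ge0}\frac{u_j}{\beta^{j+1}},$$ and let $\beta_{\underline u}\ge1$ be the number such that $$\{(\alpha',\beta')\in[0,1)\times(1,\infty):\underline u^{\alpha',\beta'}=\underline u\}=\{(\alpha(\beta),\beta):\beta\in I_{\underline u}\},$$ where $I_{\underline u}=(\beta_{\underline u},\infty)$ or $I_{\underline u}=[\beta_{\underline u},\infty)$. Then for every $\beta>\beta_{\underline u}$, the orbit of $x=0$ under $T_{\alpha(\beta),\beta}$ is not $\mu_{\alpha(\beta),\beta}$-normal.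
   Context: For $\beta>1$ and $\alpha\in[0,1)$, $T_{\alpha,\beta}(x)=\beta x+\alpha \bmod 1$. It is a piecewise monotone map of $[0,1]$, defined by right-continuity at its discontinuity points in $(0,1)$; thus on $[0,1)$ it is $T_{\alpha,\beta}(x)=\beta x+\alpha-\lfloor\beta x+\alpha\rfloor\in[0,1)$ (and at $1$ it is given by its left limit). The map $T_{\alpha,\beta}$ has a unique invariant Borel probability measure of maximal entropy (with entropy $\log\beta$), denoted $\mu_{\alpha,\beta}$; it is absolutely continuous with respect to Lebesgue measure and ergodic. Coding: for $x\in[0,1)$, ${\tt i}^{\alpha,\beta}(x)={\tt i}^{\alpha,\beta}_0(x){\tt i}^{\alpha,\beta}_1(x)\dots$ is the sequence of nonnegative integers ${\tt i}^{\alpha,\beta}_n(x)=\lfloor\beta T_{\alpha,\beta}^n(x)+\alpha\rfloor\in\{0,\dots,\lceil\alpha+\beta\rceil-1\}$, and $\underline u^{\alpha,\beta}:={\tt i}^{\alpha,\beta}(0)$. For every $\underline u$ of the form $\underline u^{\alpha_0,\beta_0}$, a number $\beta_{\underline u}\ge1$ with the property used in the statement exists. Normality: for a compact metric space $X$, a measurable map $T:X\to X$ and an ergodic $T$-invariant Borel probability measure $\mu$, the orbit of $x\in X$ under $T$ is $\mu$-normal if the only weak$^*$ cluster point of the empirical measures $\frac1n\sum_{i=0}^{n-1}\delta_{T^i x}$ is $\mu$, i.e. if for every continuous $f:X\to\mathbb R$, $\lim_{n\to\infty}\frac1n\sum_{i=0}^{n-1}f(T^ix)=\int f\,d\mu$.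 Here $X=[0,1]$. *)

(* Defs.v *)
From HB Require Import structures.
From mathcomp Require Import all_boot all_order all_algebra.
From mathcomp Require Import all_classical all_reals all_analysis.
Set Implicit Arguments.
Unset Strict Implicit.
Unset Printing Implicit Defensive.
Import Order.TTheory GRing.Theory Num.Theory.
Import numFieldNormedType.Exports.
Local Open Scope classical_set_scope.
Local Open Scope ring_scope.

Section entropy.
Context (d : measure_display) (X : measurableType d) (R : realType).

Definition invariant_measure (T : X -> X) (mu : probability X R) : Prop :=
  forall A : set X, measurable A -> mu (T @^-1` A) = mu A.

(* A finite measurable partition with k (possibly empty) cells is given by the
   map xi sending a point to the index of its cell. *)
Definition measurable_partition (k : nat) (xi : X -> 'I_k) : Prop :=
  forall i, measurable (xi @^-1` [set i]).

(* Shannon entropy of the join of T^-i xi for i < n; its cells are indexed by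
   the words w of length n.  The convention 0 * ln 0 = 0 holds automatically. *)
Definition join_entropy (T : X -> X) (mu : probability X R)
    (k : nat) (xi : X -> 'I_k) (n : nat) : R :=
  \sum_(w : {ffun 'I_n -> 'I_k})
    let p := fine (mu [set x | forall i : 'I_n, xi (iter i T x) = w i]) in
    - (p * ln p).

Definition partition_entropy (T : X -> X) (mu : probability X R)
    (k : nat) (xi : X -> 'I_k) : R :=
  limn (fun n : nat => join_entropy T mu xi n / n%:R).

(* Kolmogorov-Sinai entropy *)
Definition entropy (T : X -> X) (mu : probability X R) : \bar R :=
  ereal_sup [set h | exists (k : nat) (xi : X -> 'I_k),
    measurable_partition xi /\ h = (partition_entropy T mu xi)%:E].

End entropy.

Section unit_interval.
Context (R : realType).

(* Borel probability measures on the compact space [0, 1] are represented by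
   the Borel probability measures on R that are carried by `[0, 1], and maps
   of [0, 1] by maps R -> R, of which only the values on `[0, 1] matter. *)
Definition invariant_probability (T : R -> R)
    (mu : probability (measurableTypeR R) R) : Prop :=
  mu `[(0 : R), (1 : R)]%classic = 1%E /\ @invariant_measure _ (measurableTypeR R) R T mu.

Definition max_entropy_measure (T : R -> R)
    (mu : probability (measurableTypeR R) R) : Prop :=
  invariant_probability T mu /\
  forall nu : probability (measurableTypeR R) R, invariant_probability T nu ->
    (@entropy _ (measurableTypeR R) R T nu
       <= @entropy _ (measurableTypeR R) R T mu)%E.

Definition normal_orbit (T : R -> R)
    (mu : probability (measurableTypeR R) R) (x : R) : Prop :=
  forall f : R -> R, {within `[0, 1], continuous f} ->
    (fun n : nat => n%:R^-1 * \sum_(0 <= i < n) f (iter i T x)) @ \oo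
      --> \int[mu]_(y in `[0, 1]) f y.

(* x |-> beta * x + alpha mod 1 on [0, 1].  At x = 1 the value is the left
   limit, i.e. beta + alpha minus the largest integer < beta + alpha, which
   is 1 rather than 0 when beta + alpha is an integer. *)
Definition Tab (alpha beta : R) (x : R) : R :=
  let y := beta * x + alpha in
  if x == 1 then y - (Num.ceil y - 1)%:~R else y - (Num.floor y)%:~R.

Definition coding (alpha beta : R) (x : R) (n : nat) : int :=
  Num.floor (beta * iter n (Tab alpha beta) x + alpha).

Definition alpha_of (u : nat -> int) (beta : R) : R :=
  (beta - 1) * limn (series (fun j : nat => (u j)%:~R / beta ^+ j.+1)).

End unit_interval.

(* Main.v *)
(* If the orbit of 0 under T = T_{alpha(beta),beta} were mu-normal, then mu would
   be carried by the closure of this orbit, so that mu-almost every point would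
   have a coding made of words of u (up to one jump at a discontinuity, followed
   by a prefix of u).  But u is also the coding of 0 under T_{alpha(b'),b'} with
   beta_u < b' < beta, and a map of slope b' has only O(b'^n) words of length n,
   so the entropy of mu would be at most log b'.  On the other hand, T has an
   invariant probability measure with bounded density, of entropy at least
   log beta > log b', which contradicts the maximality of the entropy of mu. *)

Require Import Defs.
From HB Require Import structures.
From mathcomp Require Import all_boot all_order all_algebra.
From mathcomp Require Import all_classical all_reals all_analysis.
From mathcomp Require Import measurable_realfun ring lra.
Import Order.TTheory GRing.Theory Num.Theory.
Import numFieldNormedType.Exports.
Local Open Scope classical_set_scope.
Local Open Scope ring_scope.

Set Implicit Arguments.
Unset Strict Implicit.
Unset Printing Implicit Defensive.

(** * Codings and the number of words *)

(** The bound O(beta^n) on the number of words serves twice: at slope b' it counts the words of the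
    closure, and at slope beta it bounds the Lebesgue measure of n-th preimages uniformly in n. The
    second use is why the count must carry no subexponential factor. Entropy is a supremum over all
    finite measurable partitions, so its upper bound has to treat an arbitrary one: the partition is
    approximated by a function of words of length m, and Gibbs' inequality with weights that
    tolerate errors charges a small price per mismatch. [partition_entropy] is a [limn], which has a
    default value on divergent sequences. The lower bound therefore has to establish convergence for
    the partition into digits, and borrows the upper bound at slope beta to do so. *)

Section coding.
Context (R : realType) (alpha beta : R).
Implicit Types (x y : R) (n m : nat).

Local Notation T := (Tab alpha beta).

(** Unlike [coding], this follows the left-limit convention of [Tab] at 1, so that [TabE] holds at
    every point; the two agree on orbits that avoid 1. *)
Definition digit x : int :=
  if x == 1 then Num.ceil (beta * x + alpha) - 1
  else Num.floor (beta * x + alpha).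

Fixpoint word n x : seq int :=
  if n is n'.+1 then digit x :: word n' (T x) else [::].

Lemma TabE x : T x = beta * x + alpha - (digit x)%:~R.
Proof. by rewrite /Tab /digit; case: ifP. Qed.

Lemma Tab_lt1 x : x != 1 -> T x < 1.
Proof.
move=> x1; rewrite TabE /digit (negbTE x1) ltrBlDl.
by have := floorD1_gt (beta * x + alpha); rewrite intrD.
Qed.

Lemma Tab_itv01 x : 0 <= T x <= 1.
Proof.
rewrite TabE /digit; case: ifP => _; last first.
  have := floor_itv (beta * x + alpha); rewrite intrD => /andP[? ?].
  by apply/andP; split; lra.
have := ceil_itv (beta * x + alpha); rewrite intrB => /andP[? ?].
by apply/andP; split; lra.
Qed.

Lemma iter_Tab_itv01 n x : 0 <= x <= 1 -> 0 <= iter n T x <= 1.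
Proof. by case: n => //= n _; exact: Tab_itv01. Qed.

Lemma iter_Tab_lt1 n x : x < 1 -> iter n T x < 1.
Proof. by elim: n => //= n IHn /IHn ?; rewrite Tab_lt1// lt_eqF. Qed.

Lemma size_word n x : size (word n x) = n.
Proof. by elim: n x => //= n IHn x; rewrite IHn. Qed.

Lemma wordD m n x : word (m + n) x = word m x ++ word n (iter m T x).
Proof. by elim: m x => //= m IHm x; rewrite IHm -iterSr. Qed.

Lemma take_word m n x : (m <= n)%N -> take m (word n x) = word m x.
Proof.
by move=> /subnKC <-; rewrite wordD take_cat size_word ltnn subnn take0 cats0.
Qed.

Lemma nth_word n x i : (i < n)%N -> nth 0 (word n x) i = digit (iter i T x).
Proof.
by elim: n x i => // n IHn x [|i]//=; rewrite ltnS => /IHn ->; rewrite -iterSr.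
Qed.

Lemma iter_Tab_affine n x y : word n x = word n y ->
  iter n T y = iter n T x + beta ^+ n * (y - x).
Proof.
elim: n x y => [|n IHn] x y /=; first by rewrite expr0 mul1r subrKC.
case=> dxy /IHn; rewrite -!iterSr !iterS => ->.
by rewrite !TabE dxy exprSr; ring.
Qed.

Hypothesis beta_gt1 : 1 < beta.
Let beta_gt0 : 0 < beta. Proof. exact: lt_trans beta_gt1. Qed.

(** The n-th images both lie in [0, 1] and their difference is beta^n times that of x and y. *)
Lemma word_dist n x y : 0 <= x <= 1 -> 0 <= y <= 1 ->
  word n x = word n y -> `|x - y| <= (beta ^+ n)^-1.
Proof.
move=> x01 y01 /iter_Tab_affine.
have /andP[] := iter_Tab_itv01 n x01; have /andP[] := iter_Tab_itv01 n y01.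
move: (iter n T x) (iter n T y) => a b b0 b1 a0 a1 baE.
have qn : 0 < beta ^+ n by rewrite exprn_gt0.
rewrite -(ler_pM2l qn) divff ?gt_eqF// -[X in X * _]gtr0_norm// -normrM.
by rewrite mulrBr ler_norml; apply/andP; split; lra.
Qed.

(** * One-sided limits of words *)

Lemma digit_right x : x < 1 -> exists2 d, 0 < d &
  forall y, x <= y < x + d -> y < 1 /\ digit y = digit x.
Proof.
move=> x1; have fx := floorD1_gt (beta * x + alpha).
pose e := ((Num.floor (beta * x + alpha) + 1)%:~R - (beta * x + alpha)) / beta.
exists (Num.min (1 - x) e) => [|y].
  by rewrite lt_min subr_gt0 x1 divr_gt0// subr_gt0.
rewrite -ltrBlDl lt_min => /and3P[xy y1]; rewrite ltr_pdivlMr// => ye.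
have {}y1 : y < 1 by lra.
split => //; rewrite /digit !lt_eqF//; apply: floor_def; apply/andP; split.
  by apply: (le_trans (floor_le _)); rewrite lerD2r ler_pM2l.
lra.
Qed.

Lemma word_right n x : x < 1 -> exists2 d, 0 < d &
  forall y, x <= y < x + d -> word n y = word n x.
Proof.
elim: n x => [|n IHn] x x1; first by exists 1.
have [d d0 hd] := digit_right x1.
have [e e0 he] := IHn (T x) (Tab_lt1 (negbT (lt_eqF x1))).
exists (Num.min d (e / beta)) => [|y]; first by rewrite lt_min d0 divr_gt0.
rewrite -ltrBlDl lt_min ltr_pdivlMr// => /and3P[xy yd ye] /=.
have [_ dyx] : y < 1 /\ digit y = digit x by apply: hd; lra.
rewrite dyx he// !TabE dyx lerD2r lerD2r ler_pM2l// xy/=; lra.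
Qed.

(** The largest integer strictly below beta * x + alpha, hence the digit read just to the left of
    x. *)
Definition left_digit x : int := Num.ceil (beta * x + alpha) - 1.

Lemma digit_left x : 0 < x <= 1 -> exists2 d, 0 < d &
  forall y, x - d < y < x -> 0 <= y < 1 /\ digit y = left_digit x.
Proof.
move=> /andP[x0 x1]; have cx := ceilB1_lt (beta * x + alpha).
exists (Num.min x ((beta * x + alpha - (left_digit x)%:~R) / beta)) => [|y].
  by rewrite lt_min x0 divr_gt0// subr_gt0.
rewrite ltrBlDr -ltrBlDl lt_min ltr_pdivlMr// => /andP[/andP[y0 yd] yx].
have y1 : y < 1 by lra.
split; first lra.
rewrite /digit lt_eqF//; apply: floor_def; rewrite subrK; apply/andP; split.
  lra.
by apply: lt_le_trans (ceil_ge _); rewrite ltrD2r ltr_pM2l.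
Qed.

(** The digits differ only where beta * x + alpha is an integer; there the orbit lands on 0, which
    is how prefixes of the coding of 0 enter. *)
Lemma digit_cases x :
  digit x = left_digit x \/ digit x = left_digit x + 1 /\ T x = 0.
Proof.
rewrite TabE /digit /left_digit; case: ifP => _; first by left.
rewrite ceil_floor; case: (boolP (_ \is a _)) => [xZ|_].
  2: by left; rewrite addrK.
right; rewrite addr0 subrK; split=> //; apply/eqP; rewrite subr_eq0 eq_sym.
by rewrite -intrEfloor.
Qed.

(* [v] is the word of the left limits; the word of [x] can only differ from it
   after the orbit of [x] has hit a discontinuity, from where it follows the
   orbit of [0]. *)
Lemma word_left n x : 0 < x <= 1 -> exists2 d, 0 < d & exists v,
  (forall y, x - d < y < x -> word n y = v) /\
  (word n x = v \/ exists2 k, (k < n)%N &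
     word n x = rcons (take k v) (nth 0 v k + 1) ++ word (n - k.+1) 0).
Proof.
elim: n x => [|n IHn] x x01.
  by exists 1 => //; exists [::]; split => //; left.
have [d d0 hd] := digit_left x01.
have z01 : 0 < beta * x + alpha - (left_digit x)%:~R <= 1.
  have := ceil_itv (beta * x + alpha); rewrite /left_digit intrB => /andP[? ?].
  by apply/andP; split; lra.
have [e e0 [v [ev hv]]] := IHn _ z01.
exists (Num.min d (e / beta)); first by rewrite lt_min d0 divr_gt0.
exists (left_digit x :: v); split => [y|].
  rewrite ltrBlDr -ltrBlDl lt_min ltr_pdivlMr// => /andP[/andP[yd ye] yx] /=.
  have [_ dy] : 0 <= y < 1 /\ digit y = left_digit x by apply: hd; lra.
  rewrite dy ev// TabE dy ltrD2r ltrD2r ltr_pM2l// yx andbT; lra.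
have [dx|[dx Tx]] := digit_cases x; last first.
  by right; exists 0%N => //=; rewrite subn1 dx Tx.
rewrite /= TabE dx; case: hv => [->|[k kn ->]]; first by left.
by right; exists k.+1.
Qed.

Definition few n (X : set R) (K : R) := exists2 s : seq (seq int),
  (size s)%:R <= K & forall x, X x -> word n x \in s.

Lemma few_le n X Y K L : Y `<=` X -> K <= L -> few n X K -> few n Y L.
Proof.
by move=> YX KL [s sK hs]; exists s; [exact: le_trans KL|move=> x /YX/hs].
Qed.

Lemma few_set0 n K : 0 <= K -> few n set0 K.
Proof. by exists [::]. Qed.

Lemma few_setU n X Y K L : few n X K -> few n Y L -> few n (X `|` Y) (K + L).
Proof.
move=> [s sK hs] [t tL ht]; exists (s ++ t); first by rewrite size_cat natrD lerD.
by move=> x [/hs|/ht] xs; rewrite mem_cat xs// orbT.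
Qed.

Lemma few_itvU n a b c K L : few n `[a, b[ K -> few n `[b, c[ L ->
  few n `[a, c[ (K + L).
Proof.
move=> hK /(few_setU hK); apply: few_le => // x /=; rewrite !in_itv/=.
by move=> ?; have [?|?] := ltP x b; [left|right]; lra.
Qed.

Lemma few_take m n X K : (m <= n)%N -> few n X K -> few m X K.
Proof.
move=> mn [s sK hs]; exists (map (take m) s); first by rewrite size_map.
by move=> x /hs xs; rewrite -(take_word x mn); exact: map_f.
Qed.

(** Where the m-word is constant, the m-th iterate is affine of slope beta^m, so the remaining n
    letters are n-words of an image interval that is beta^m times longer. *)
Lemma few_step m n a b K : 0 <= a < b -> b <= 1 ->
    (forall x, a <= x < b -> word m x = word m a) ->
    (forall c d, 0 <= c -> c <= d -> d <= 1 -> d - c = beta ^+ m * (b - a) ->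
       few n `[c, d[ K) ->
  few (m + n) `[a, b[ K.
Proof.
move=> /andP[a0 ab] b1 wa IH; set q := beta ^+ m.
have q0 : 0 < q by rewrite exprn_gt0.
have aff x : a <= x < b -> iter m T x = iter m T a + q * (x - a).
  by move=> /wa/esym/iter_Tab_affine.
have a01 : 0 <= a <= 1 by lra.
have /andP[Ta0 _] := iter_Tab_itv01 m a01.
have Ta1 : iter m T a < 1 by apply: iter_Tab_lt1; lra.
have Tb1 : iter m T a + q * (b - a) <= 1.
  (* Otherwise the point x of [a, b) that the affine branch sends to 1 contradicts
     [iter_Tab_lt1]. *)
  rewrite leNgt; apply/negP => Tb.
  pose x := a + (1 - iter m T a) / q.
  have xb : a <= x < b.
    rewrite /x lerDl divr_ge0 ?subr_ge0 ?(ltW Ta1) ?(ltW q0)//=.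
    by rewrite -ltrBrDl ltr_pdivrMr// mulrC ltrBlDl.
  have /(iter_Tab_lt1 m) : x < 1 by lra.
  rewrite aff// /x [a + _]addrC addrK mulrCA divff ?gt_eqF// mulr1 subrKC.
  by rewrite ltxx.
have [||||s sK hs] := IH (iter m T a) (iter m T a + q * (b - a)) => //.
- by rewrite lerDl mulr_ge0 ?(ltW q0)// subr_ge0 ltW.
- by rewrite addrC addKr.
exists (map (cat (word m a)) s); first by rewrite size_map.
move=> x /=; rewrite in_itv/= => xab.
rewrite wordD wa// map_f// hs//= in_itv/= (aff x)// lerDl ltrD2l ltr_pM2l// ltrD2r.
by case/andP: xab => ax ->; rewrite andbT mulr_ge0 ?(ltW q0)// subr_ge0.
Qed.


(** Each point has a radius within which the m-word is constant on either side of it; compactness of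
    [0, 1] makes the radius uniform, so a short interval needs a single cut. *)
Lemma word_cut m : exists2 d, 0 < d & forall a b, 0 <= a -> a < b -> b <= 1 ->
  b - a <= d -> exists c, [/\ a <= c <= b,
    forall x, a <= x < c -> word m x = word m a &
    forall x, c <= x < b -> word m x = word m c].
Proof.
have /compact_near_coveringP cpt := @segment_compact R 0 1.
pose P (d x : R) := forall a b : R, 0 <= a -> a < b -> b <= 1 ->
  `|a - x| <= d -> `|b - x| <= d -> exists c, [/\ a <= c <= b,
    forall x, a <= x < c -> word m x = word m a &
    forall x, c <= x < b -> word m x = word m c].
have : \forall d \near 0^'+, `[0, 1] `<=` P d.
  apply: cpt => x /=; rewrite in_itv/= => x01.
  have [d d0 [hl hr]] : exists2 d, 0 < d &
      (forall y z, 0 <= y -> 0 <= z -> x - d < y < x -> x - d < z < x ->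
         word m y = word m z) /\
      (forall y z, y < 1 -> z < 1 -> x <= y < x + d -> x <= z < x + d ->
         word m y = word m z).
    have [d d0 hd] : exists2 d, 0 < d &
        forall y z, 0 <= y -> 0 <= z -> x - d < y < x -> x - d < z < x ->
         word m y = word m z.
      have [x0|x0] := eqVneq x 0; first by exists 1 => // *; exfalso; lra.
      have [|d d0 [v [hv _]]] := @word_left m x; first by rewrite lt0r x0; lra.
      by exists d => // y z _ _ /hv -> /hv ->.
    have [e e0 he] : exists2 d, 0 < d &
        forall y z, y < 1 -> z < 1 -> x <= y < x + d -> x <= z < x + d ->
         word m y = word m z.
      have [x1|x1] := eqVneq x 1; first by exists 1 => // *; exfalso; lra.
      have [|d' d'0 hv] := @word_right m x; first by rewrite lt_neqAle x1; lra.
      by exists d' => // y z _ _ /hv -> /hv ->.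
    exists (Num.min d e); first by rewrite lt_min d0.
    have [dm em] : Num.min d e <= d /\ Num.min d e <= e.
      by rewrite !ge_min !lexx orbT.
    by split => y z *; [apply: hd|apply: he] => //; lra.
  (* With half the radius for the centre and half for the length, both endpoints of the interval are
     within d of x. *)
  exists (ball x (d / 2), [set e | e < d / 2]); first split.
  - by apply: nbhsx_ballx; rewrite divr_gt0.
  - by apply: nbhs_right_lt; rewrite divr_gt0.
  move=> [x' e] [/=]; rewrite /ball/= => xx' ed a b a0 ab b1.
  rewrite !ler_norml => ha hb; move: xx'; rewrite ltr_norml => xx'.
  have [cx|cx] := leP x a.
    exists b; split => [|y yab|y yb]; [lra| |exfalso; lra].
    by apply: hr; lra.
  have [bx|bx] := leP b x.
    exists b; split => [|y yab|y yb]; [lra| |exfalso; lra].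
    by apply: hl; lra.
  by exists x; split => [|y yab|y yab]; [lra|apply: hl; lra|apply: hr; lra].
move=> [d /= d0 hd]; exists (d / 2); first by rewrite divr_gt0.
move=> a b a0 ab b1 bad.
have : P (d / 2) a.
  apply: hd; rewrite /= ?sub0r ?normrN ?gtr0_norm; try lra.
  by rewrite in_itv/=; lra.
by apply => //; rewrite ?subrr ?normr0; [lra|rewrite gtr0_norm; lra].
Qed.

(** The interval is split into N pieces of length at most d, each cut once more: the slope term A is
    multiplied by beta^m, while the constant B is paid 2 * N times. *)
Lemma few_words_step m : exists2 d, 0 < d & forall j A B, 0 <= A -> 0 <= B ->
  (forall a b, 0 <= a <= b -> b <= 1 -> few j `[a, b[ (A * (b - a) + B)) ->
  forall N a b, 0 <= a <= b -> b <= 1 -> b - a <= N%:R * d ->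
    few (m + j) `[a, b[ (beta ^+ m * A * (b - a) + N%:R * (2 * B)).
Proof.
have [d d0 hd] := word_cut m; exists d => // j A B A0 B0 IH.
have q0 : 0 < beta ^+ m by rewrite exprn_gt0.
have fewE a b : 0 <= a <= b -> b <= 1 ->
    (forall x, a <= x < b -> word m x = word m a) ->
    few (m + j) `[a, b[ (beta ^+ m * A * (b - a) + B).
  move=> /andP[a0]; rewrite le_eqVlt => /predU1P[<- _ _|ab b1 hab].
    rewrite set_itvco0// subrr mulr0 add0r; exact: few_set0.
  apply: few_step => //; first by rewrite a0.
  move=> c e c0 ce e1 ceE; rewrite -mulrA mulrCA -ceE.
  by apply: IH => //; rewrite c0.
elim=> [|N IHN] a b /andP[a0 ab] b1 Nd.
  have -> : b = a by lra.
  by rewrite set_itvco0// subrr mulr0 mul0r add0r; exact: few_set0.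
have [abd|dab] := leP (b - a) d.
  move: ab; rewrite le_eqVlt => /predU1P[->|ab].
    rewrite set_itvco0// subrr mulr0 add0r.
    by apply: few_set0; rewrite !mulr_ge0.
  have [c [/andP[ac cb] hl hr]] := hd a b a0 ab b1 abd.
  apply: (few_le _ _ (few_itvU (fewE a c _ _ hl) (fewE c b _ _ hr))) => //;
    rewrite ?a0 ?(le_trans a0 ac) ?(le_trans cb b1)//.
  have : 0 <= N%:R * (2 * B) by rewrite !mulr_ge0.
  rewrite -natr1; lra.
have hl : few (m + j) `[a, a + d[ (beta ^+ m * A * d + 2 * B).
  have [||||c [/andP[ac cb] hl hr]] := hd a (a + d); try lra.
  apply: (few_le _ _ (few_itvU (fewE a c _ _ hl) (fewE c (a + d) _ _ hr))) => //;
    rewrite ?a0 ?(le_trans a0 ac)//; lra.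
have hr : few (m + j) `[a + d, b[
    (beta ^+ m * A * (b - (a + d)) + N%:R * (2 * B)).
  by apply: IHN => //; move: Nd; rewrite -natr1; lra.
by apply: few_le (few_itvU hl hr) => //; rewrite -natr1; lra.
Qed.

(* Cutting at the points given by [word_cut] at most doubles the number of pieces
   of a short interval every [m] steps, while its length is multiplied by
   [beta ^+ m > 2], so that the pieces created by the cuts are negligible. *)
Lemma few_words_power m : 2 < beta ^+ m -> exists2 C, 0 <= C &
  forall j a b, 0 <= a <= b -> b <= 1 ->
  few (j * m) `[a, b[ (C * ((beta ^+ m) ^+ j - 2 ^+ j) * (b - a) + 2 ^+ j).
Proof.
move=> q2; set q := beta ^+ m.
have q20 : 0 < q - 2 by rewrite subr_gt0.
have [d d0 step] := few_words_step m.
have qj j : 0 <= q ^+ j - 2 ^+ j.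
  by rewrite subr_ge0 lerXn2r ?nnegrE//; rewrite /q; lra.
(* As N is at most (b - a) / d + 1, the coefficient of the length satisfies A_(j+1) = q * A_j + (2 /
   d) * 2^j with A_0 = 0; this constant is the one in its solution. *)
exists (2 / d / (q - 2)) => [|j]; first by rewrite !divr_ge0// ltW.
elim: j => [|j IHj] a b ab b1.
  exists [:: [::]] => //=; rewrite !expr0; lra.
have l0 : 0 <= (b - a) / d by rewrite divr_ge0// ?(ltW d0)//; lra.
have /andP[Nl Nu] := truncn_itv l0.
have C0 : 0 <= 2 / d / (q - 2) by rewrite !divr_ge0// ltW.
have ld : b - a <= (Num.truncn ((b - a) / d)).+1%:R * d.
  by rewrite -ler_pdivrMr// ltW.
have H := step (j * m)%N _ _ (mulr_ge0 C0 (qj j)) (exprn_ge0 j (ler0n R 2)) IHj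
  _ a b ab b1 ld.
apply: few_le H => //; rewrite -/q.
set N := (Num.truncn _).+1%:R.
have N1 : N <= (b - a) / d + 1 by rewrite /N -natr1 lerD2r.
have : N * (2 * 2 ^+ j) <= ((b - a) / d + 1) * (2 * 2 ^+ j).
  by rewrite ler_pM2r// mulr_gt0// exprn_gt0.
have -> : 2 / d / (q - 2) * (q ^+ j.+1 - 2 ^+ j.+1) * (b - a) + 2 ^+ j.+1 =
    q * (2 / d / (q - 2) * (q ^+ j - 2 ^+ j)) * (b - a)
    + ((b - a) / d + 1) * (2 * 2 ^+ j).
  by rewrite !exprS; field; rewrite !gt_eqF.
by rewrite lerD2l.
Qed.

Lemma expr_gt2 : exists m, 2 < beta ^+ m.
Proof.
(* Bernoulli's inequality. *)
have h n : 1 + n%:R * (beta - 1) <= beta ^+ n.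
  elim: n => [|n IHn]; first by rewrite mul0r addr0 expr0.
  rewrite exprS -natr1 mulrDl mul1r.
  have : beta * (1 + n%:R * (beta - 1)) <= beta * beta ^+ n by rewrite ler_pM2l.
  have : 0 <= n%:R * (beta - 1) * (beta - 1).
    by rewrite !mulr_ge0// subr_ge0 ltW.
  move: (n%:R * (beta - 1)) (beta ^+ n) => u v; lra.
have b0 : 0 < beta - 1 by rewrite subr_gt0.
exists (Num.truncn (1 / (beta - 1))).+1; apply: lt_le_trans (h _).
by rewrite -[2]/(1 + 1) ltrD2l -ltr_pdivrMr// truncnS_gt.
Qed.

Lemma few_words : exists2 C, 0 < C & forall n, few n `[0, 1[ (C * beta ^+ n).
Proof.
have [m q2] := expr_gt2; have [C C0 hC] := few_words_power q2.
have m0 : (0 < m)%N by case: m q2 {hC} => //; rewrite expr0; lra.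
(* Rounding n up to a multiple of m costs the factor beta^m; the additional 1 absorbs the term
   2^j. *)
exists ((C + 1) * beta ^+ m) => [|n].
  by rewrite mulr_gt0 ?exprn_gt0//; lra.
pose j := (n %/ m).+1; have nj : (n <= j * m)%N by rewrite ltnW// ltn_ceil.
apply: (few_take nj); apply: few_le (hC j 0 1 _ _) => //;
  last by rewrite lexx ler01.
rewrite subr0 mulr1 -mulrA -exprD -exprM.
have -> : (m * j = m + n %/ m * m)%N by rewrite mulnC mulSn.
have h1 : beta ^+ (m + n %/ m * m) <= beta ^+ (m + n).
  by rewrite ler_eXn2l// leq_add2l leq_trunc_div.
have h2 : 2 ^+ j <= beta ^+ (m + n %/ m * m).
  by rewrite -mulSn -/j mulnC exprM; apply: lerXn2r;
    rewrite ?nnegrE ?exprn_ge0// ltW.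
have : 0 <= C * 2 ^+ j by rewrite mulr_ge0// exprn_ge0.
have : C * beta ^+ (m + n %/ m * m) <= C * beta ^+ (m + n) by rewrite ler_wpM2l.
lra.
Qed.

End coding.

(** * Finite-valued random variables *)

Section finite_valued.
Context (d : measure_display) (X : measurableType d) (R : realType)
  (P : probability X R).

Lemma fine_probability_ge0 (A : set X) : 0 <= fine (P A).
Proof. exact/fine_ge0/measure_ge0. Qed.

Lemma fine_probability_le (A B : set X) : measurable A -> measurable B ->
  A `<=` B -> fine (P A) <= fine (P B).
Proof.
move=> mA mB AB; rewrite fine_le ?fin_num_measure//.
by apply: le_measure; rewrite ?inE.
Qed.

Lemma fine_probability_setT : fine (P setT) = 1.
Proof. by rewrite probability_setT. Qed.

Variables (F : finType) (Y : X -> F).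
Hypothesis mY : forall f, measurable (Y @^-1` [set f]).

Lemma measurable_finite_valued (B : pred F) : measurable [set x | B (Y x)].
Proof.
have -> : [set x | B (Y x)] = \bigcup_(f in [set f | B f]) (Y @^-1` [set f]).
  apply/seteqP; split => x /=; first by exists (Y x).
  by move=> [f Bf Yf]; rewrite Yf.
by apply: fin_bigcup_measurable => // f _; exact: mY.
Qed.

Lemma fine_probability_finite_valued (B : pred F) :
  fine (P [set x | B (Y x)]) = \sum_(f | B f) fine (P (Y @^-1` [set f])).
Proof.
pose Q (r : seq F) := fine (P [set x | Y x \in r]).
suff H (r : seq F) : uniq r -> Q r = \sum_(f <- r) fine (P (Y @^-1` [set f])).
  have := H [seq f <- index_enum F | B f] (filter_uniq _ (index_enum_uniq F)).
  rewrite big_filter => <-; congr (fine (P _)).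
  by apply/funext => x /=; rewrite mem_filter mem_index_enum andbT.
elim: r => [_|f r IHr /= /andP[fr ur]].
  rewrite big_nil /Q (_ : [set _ | _] = set0) ?measure0//.
  by rewrite -subset0 => x.
rewrite big_cons -IHr// /Q.
rewrite (_ : [set _ | _] = Y @^-1` [set f] `|` [set x | Y x \in r]).
  rewrite measureU// ?fineD ?fin_num_measure//; try exact: measurable_finite_valued.
  by rewrite -subset0 => x /= [->]; exact/negP.
apply/seteqP; split => x /=; rewrite inE.
  by move=> /predU1P[->|->]; [left|right].
by move=> [->|->]; rewrite ?eqxx ?orbT.
Qed.

Lemma fine_probability_marginal (G : finType) (g : F -> G) (c : G) :
  fine (P [set x | g (Y x) = c])
  = \sum_(f | g f == c) fine (P (Y @^-1` [set f])).
Proof.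
rewrite -fine_probability_finite_valued; congr (fine (P _)).
by apply/funext => x /=; apply/propext; split => /eqP.
Qed.

End finite_valued.

(** Nonnegativity of relative entropy, termwise from ln t <= t - 1 at t = q f / p f. *)
Lemma gibbs (R : realType) (F : finType) (p q : F -> R) :
  (forall f, 0 <= p f) -> (forall f, 0 < q f) ->
  \sum_f p f = 1 -> \sum_f q f <= 1 ->
  \sum_f - (p f * ln (p f)) <= \sum_f - (p f * ln (q f)).
Proof.
move=> p0 q0 p1 q1; rewrite -subr_ge0 -sumrB.
apply: (@le_trans _ _ (\sum_f (p f - q f))); first by rewrite sumrB p1 subr_ge0.
apply: ler_sum => f _; have := p0 f; rewrite le_eqVlt => /predU1P[<-|pf].
  by rewrite !mul0r subrr sub0r oppr_le0 ltW.
have /le_ln1Dx : -1 < q f / p f - 1.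
  by rewrite ltrBrDr addNr divr_gt0.
rewrite subrKC ln_div ?posrE// => h.
have := ler_wpM2l (ltW pf) h; rewrite !mulrBr mulr1 mulrCA divff ?gt_eqF// mulr1.
lra.
Qed.

(** * Entropy from a list of codes *)

Section invariant.
Context (d : measure_display) (X : measurableType d) (R : realType).
Variables (T : X -> X) (mu : probability X R).
Hypothesis measurable_T : forall A, measurable A -> measurable (T @^-1` A).
Hypothesis inv : invariant_measure T mu.

Lemma measurable_iter_preimage n A : measurable A ->
  measurable (iter n T @^-1` A).
Proof.
elim: n A => // n IHn A mA.
rewrite (_ : _ @^-1` _ = iter n T @^-1` (T @^-1` A))//.
exact/IHn/measurable_T.
Qed.

Lemma invariant_iter n A : measurable A -> mu (iter n T @^-1` A) = mu A.
Proof.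
elim: n A => // n IHn A mA.
rewrite (_ : _ @^-1` _ = iter n T @^-1` (T @^-1` A))//.
by rewrite IHn ?inv//; exact: measurable_T.
Qed.

Variables (k : nat) (xi : X -> 'I_k).
Hypothesis mxi : measurable_partition xi.

(* Gibbs' inequality against the weights [q w], averages over the codes in [s] of
   a factor [e / k] for every mismatch between [w] and the word predicted from
   the code, and [1 - e] for every match. *)
Lemma join_entropy_le n (S : eqType) (c : X -> S) (phi : 'I_n -> S -> 'I_k)
    (s : seq S) (del e : R) : 0 < e < 1 ->
  mu.-negligible [set x | c x \notin s] ->
  (forall i, measurable [set x | phi i (c x) != xi (iter i T x)]) ->
  (forall i, (mu [set x | phi i (c x) != xi (iter i T x)] <= del%:E)%E) ->
  join_entropy T mu xi n <=
    ln (size s)%:R + n%:R * (- ln (1 - e) + del * ln (k%:R / e)).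
Proof.
move=> /andP[e0 e1] ns mD dD.
pose D i := [set x | phi i (c x) != xi (iter i T x)].
(* The joint law of the word and of its mismatch pattern is needed: entropy depends on the word, the
   average cost on the pattern. *)
pose F := ({ffun 'I_n -> 'I_k} * {ffun 'I_n -> bool})%type.
pose Y x : F := ([ffun i : 'I_n => xi (iter i T x)],
                 [ffun i : 'I_n => phi i (c x) != xi (iter i T x)]).
have mY f : measurable (Y @^-1` [set f]).
  rewrite (_ : _ @^-1` _ = \bigcap_(i in [set: 'I_n])
      ((iter i T @^-1` (xi @^-1` [set f.1 i])) `&`
       (if f.2 i then D i else ~` D i))).
    apply: fin_bigcap_measurable => // i _; apply: measurableI.
      exact/measurable_iter_preimage/mxi.
    by case: (f.2 i); [|apply: measurableC]; exact: mD.
  apply/seteqP; split => [x /= <- i _ /=|x h].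
    rewrite !ffunE /D; split => //; case: ifP => [//|nD] /=.
    by apply/negP; rewrite nD.
  case: f h => f g /= h; congr pair; apply/ffunP => i; rewrite ffunE.
    by have [/= -> _] := h i Logic.I.
  have [_] := h i Logic.I; rewrite /D/=; case: (g i) => //=.
  by move/negP/negbTE.
have k0 : (0 < k)%N.
  have [x _] : [set: X] !=set0.
    apply/set0P/negP => /eqP X0; have := probability_setT mu.
    by rewrite X0 measure0 => /eqP; rewrite eq_sym onee_eq0.
  exact: leq_ltn_trans (ltn_ord (xi x)).
pose E f := fine (mu (Y @^-1` [set f])).
have E0 f : 0 <= E f by exact: fine_probability_ge0.
have E1 : \sum_f E f = 1.
  rewrite /E -(fine_probability_finite_valued mu mY predT).
  rewrite -[RHS](fine_probability_setT mu).
  by congr (fine (mu _)); apply/seteqP; split.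
have K0 : (0 < size s)%N.
  rewrite lt0n; apply/negP => /nilP s0; move: ns; rewrite s0.
  rewrite (_ : [set _ | _] = setT); last by apply/seteqP; split.
  move=> /(measure_negligible measurableT) m0.
  have : (1 = 0 :> \bar R)%E by rewrite -(probability_setT mu); exact: m0.
  by move/eqP; rewrite onee_eq0.
have kR : 0 < k%:R :> R by rewrite ltr0n.
have KR : 0 < (size s)%:R :> R by rewrite ltr0n.
pose r (b : bool) : R := if b then e / k%:R else 1 - e.
have r0 b : 0 < r b by case: b; rewrite /r ?divr_gt0// subr_gt0.
pose q (w : {ffun 'I_n -> 'I_k}) : R :=
  (size s)%:R^-1 * \sum_(v <- s) \prod_i r (phi i v != w i).
have q0 w : 0 < q w.
  rewrite mulr_gt0 ?invr_gt0//; case: (s) K0 => // v t _; rewrite big_cons.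
  rewrite ltr_pwDl ?prodr_gt0 ?sumr_ge0// => u _.
  by rewrite prodr_ge0// => i _; exact: ltW.
(* For a fixed code the sum over words factors over positions, and each factor is 1 - e for the
   match plus k - 1 terms e / k. *)
have q1 : \sum_w q w <= 1.
  rewrite -mulr_sumr exchange_big/= ler_pdivrMl// mulr1.
  have -> : (size s)%:R = \sum_(v <- s) 1 :> R by rewrite -sum1_size natr_sum.
  apply: ler_sum => v _.
  rewrite -(bigA_distr_bigA (fun i j => r (phi i v != j))).
  apply: Num.Theory.prodr_ile1 => i _.
  rewrite sumr_ge0/= => [|j _]; last exact: ltW.
  rewrite (bigD1 (phi i v))//= eqxx/= -lerBrDl.
  have -> : 1 - (1 - e) = \sum_(j : 'I_k) e / k%:R.
    by rewrite sumr_const card_ord -[RHS]mulr_natr divfK ?gt_eqF//; ring.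
  rewrite [leRHS](bigD1 (phi i v))//=; apply: ler_wpDl.
    by rewrite divr_ge0 ?ltW.
  by apply: ler_sum => j; rewrite eq_sym => ->.
pose p (w : {ffun 'I_n -> 'I_k}) :=
  fine (mu [set x | forall i : 'I_n, xi (iter i T x) = w i]).
have pE w : p w = \sum_(f : F | f.1 == w) E f.
  rewrite /E -(fine_probability_marginal mu mY fst); congr (fine (mu _)).
  apply/seteqP; split => x /=; first by move=> h; apply/ffunP => i; rewrite ffunE.
  by move=> <- i; rewrite ffunE.
have p0 w : 0 <= p w by exact: fine_probability_ge0.
have p1 : \sum_w p w = 1.
  rewrite -[RHS]E1 (partition_big fst predT)//=.
  by apply: eq_bigr => w _; rewrite pE.
apply: le_trans (gibbs p0 q0 p1 q1) _.
pose cost (b : bool) : R := - ln (r b).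
have step1 : \sum_w - (p w * ln (q w)) =
    \sum_f E f * - ln (q f.1).
  rewrite (partition_big fst predT)//=; apply: eq_bigr => w _.
  rewrite pE -mulrN mulr_suml; apply: eq_bigr => f /eqP -> //.
have step2 f : E f * - ln (q f.1) <=
    E f * (ln (size s)%:R + \sum_i cost (f.2 i)).
  have := E0 f; rewrite le_eqVlt => /predU1P[<-|Ef]; first by rewrite !mul0r.
  rewrite ler_pM2l// lerNl.
  (* An event of positive mass is not contained in the negligible set of points whose code is
     missing from s. *)
  have [x [xs Yx]] : exists x, c x \in s /\ Y x = f.
    apply: contrapT => nx; have : mu.-negligible (Y @^-1` [set f]).
      apply: negligibleS ns => x /= Yx; apply/negP => cs; apply: nx.
      by exists x.
    move=> /(measure_negligible (mY f)) Y0.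
    by move: Ef; rewrite /E [mu _]Y0 ltxx.
  have fE i : f.2 i = (phi i (c x) != f.1 i) by rewrite -Yx !ffunE.
  have prodr0 : 0 < \prod_i r (f.2 i) by exact: prodr_gt0.
  have -> : - (ln (size s)%:R + \sum_i cost (f.2 i)) =
      ln ((size s)%:R^-1 * \prod_i r (f.2 i)).
    rewrite lnM ?posrE ?invr_gt0// lnV ?posrE// opprD; congr (_ + _).
    rewrite -sumrN /cost/=; under eq_bigr do rewrite opprK.
    suff [_] : 0 < \prod_i r (f.2 i) /\
      ln (\prod_i r (f.2 i)) = \sum_i ln (r (f.2 i)) by [].
    apply: (big_ind2 (fun a b => 0 < a /\ ln a = b)) => //; first by rewrite ln1.
    by move=> a b a' b' [a0 <-] [a'0 <-]; rewrite mulr_gt0// lnM.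
  rewrite ler_ln ?posrE ?q0// ?mulr_gt0 ?invr_gt0// /q ler_pM2l ?invr_gt0//.
  (* Of the average defining q, only the term of the code of x is kept. *)
  rewrite (big_rem _ xs)/=; under eq_bigr do rewrite fE.
  by rewrite lerDl sumr_ge0// => v _; rewrite prodr_ge0// => i _; exact: ltW.
rewrite step1; apply: (le_trans (ler_sum _ (fun f _ => step2 f))).
under eq_bigr do rewrite mulrDr.
rewrite big_split/= -mulr_suml E1 mul1r lerD2l.
under eq_bigr do rewrite mulr_sumr.
rewrite exchange_big/= -[n in n%:R]card_ord -sum1_card natr_sum mulr_suml.
apply: ler_sum => i _; rewrite mul1r.
have lke : 0 <= ln (k%:R / e).
  by rewrite ln_ge0// ler_pdivlMr// mul1r (le_trans (ltW e1))// ler1n.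
have l1e : ln (1 - e) <= 0 by rewrite ln_le0//; lra.
have -> : \sum_f E f * cost (f.2 i) = - ln (1 - e) +
   (\sum_(f : F | f.2 i) E f) * (ln (k%:R / e) + ln (1 - e)).
  rewrite [X in _ + X * _]big_mkcond mulr_suml.
  have -> : - ln (1 - e) = \sum_f E f * - ln (1 - e).
    by rewrite -mulr_suml E1 mul1r.
  rewrite -big_split; apply: eq_bigr => f _ /=; rewrite /cost /r.
  case: ifP => _; last by rewrite mul0r addr0.
  have -> : ln (e / k%:R) = - ln (k%:R / e).
    by rewrite -lnV ?posrE ?divr_gt0// invf_div.
  ring.
rewrite lerD2l.
have Di : \sum_(f : F | f.2 i) E f = fine (mu (D i)).
  rewrite -(fine_probability_finite_valued mu mY (fun f : F => f.2 i)).
  by congr (fine (mu _)); apply/seteqP; split => x /=; rewrite ffunE.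
have : fine (mu (D i)) <= del.
  by rewrite -lee_fin fineK ?fin_num_measure//; [exact: dD|exact: mD].
have : 0 <= fine (mu (D i)) by exact: fine_probability_ge0.
rewrite Di; move: (fine _) (ln (1 - e)) (ln (_ / _)) l1e lke => a b g; nra.
Qed.
End invariant.

(** * Measurability of the coding *)

Lemma vanishing_measure (d : measure_display) (X : measurableType d)
    (R : realType) (mu : probability X R) (F : nat -> set X) (e : R) : 0 < e ->
  (forall n, measurable (F n)) -> (forall n, F n.+1 `<=` F n) ->
  (forall x, exists n, ~ F n x) -> exists n, (mu (F n) <= e%:E)%E.
Proof.
move=> e0 mF Fn F0.
have F0E : \bigcap_n F n = set0.
  by rewrite -subset0 => x Fx; have [n] := F0 x; apply; exact: Fx.
have cvF : mu (F n) @[n --> \oo] --> mu (\bigcap_n F n).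
  apply: nonincreasing_cvg_mu => //.
  - by apply: le_lt_trans (probability_le1 _ _) _; rewrite ?ltry.
  - by rewrite F0E.
  - move=> n m /subnK <-; elim: (m - n)%N => [|k IHk]; apply/subsetPset => //.
    by rewrite addSn => x /Fn; move: x; exact/subsetPset.
have : \forall n \near \oo, fine (mu (F n)) < e.
  apply: (cvgr_lt 0) => //; apply: fine_cvg.
  by move: cvF; rewrite F0E measure0.
move=> [n _ /(_ n (leqnn n))/ltW h]; exists n.
by rewrite -[mu _]fineK ?fin_num_measure// lee_fin.
Qed.

Lemma measurable_affine (R : realType) (q s : R) :
  measurable_fun setT (fun x : measurableTypeR R => q * x + s : measurableTypeR R).
Proof.
apply: (@continuous_measurable_fun R) => x.
by apply: cvgD; [apply: cvgM|]; exact: cvg_cst || exact: cvg_id.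
Qed.

Section words.
Context (R : realType) (alpha beta : R).
Local Notation T := (Tab alpha beta).
Local Notation M := (measurableTypeR R).
Local Notation word := (word alpha beta).
Local Notation digit := (digit alpha beta).

Hypothesis beta_gt1 : 1 < beta.
Let beta_gt0 : 0 < beta. Proof. exact: lt_trans beta_gt1. Qed.

Lemma measurable_digit (k : int) : measurable ([set x | digit x = k] : set M).
Proof.
pose a (z : R) := (z - alpha) / beta.
have aE (z x : R) : (a z <= x) = (z <= beta * x + alpha).
  by rewrite /a ler_pdivrMr// lerBlDr mulrC.
have -> : [set x | digit x = k] =
    (`[a k%:~R, a (k + 1)%:~R[ `\` [set 1]) `|`
    ([set 1] `&` [set x | digit x = k]).
  have nd x : x != 1 -> (digit x = k) <-> x \in `[a k%:~R, a (k + 1)%:~R[.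
    move=> x1; rewrite /digit (negbTE x1) in_itv/= aE ltNge aE -ltNge -floor_eq.
    by split => [->//|/eqP].
  apply/seteqP; split => x /=.
    by have [->|x1] := eqVneq x 1; [right|left; split; [exact/nd|exact/eqP]].
  by move=> [[xa /eqP x1]|[]//]; exact/nd.
apply: measurableU; first by apply: measurableD => //; exact: measurable_itv.
have [k1|k1] := pselect (digit 1 = k).
  rewrite (_ : _ `&` _ = [set 1]); first exact: measurable_set1.
  by apply/seteqP; split => x //= [->].
rewrite (_ : _ `&` _ = set0)//.
by rewrite -subset0 => x /= [->].
Qed.

Lemma measurable_Tab (A : set M) : measurable A -> measurable (T @^-1` A).
Proof.
move=> mA; have -> : T @^-1` A = \bigcup_(k : int)
    ([set x | digit x = k] `&` (fun x => beta * x + alpha - k%:~R) @^-1` A).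
  apply/seteqP; split => x /=; rewrite TabE.
    by move=> Ax; exists (digit x).
  by move=> [k _ [/= ->]].
apply: countable_bigcupT_measurable => // k.
apply: measurableI; first exact: measurable_digit.
rewrite -[_ @^-1` _]setTI.
have -> : (fun x => beta * x + alpha - k%:~R) =
    (fun x => beta * x + (alpha - k%:~R)).
  by apply/funext => x; rewrite addrA.
exact: measurable_affine.
Qed.

(** Any Q is allowed because there are only countably many words. *)
Lemma measurable_word n (Q : seq int -> Prop) :
  measurable ([set x | Q (word n x)] : set M).
Proof.
have mw v : measurable ([set x | word n x = v] : set M).
  elim: n v => [|n IHn] v.
    have [->|v0] := eqVneq v [::].
      by rewrite (_ : [set _ | _] = setT)//; apply/seteqP; split.
    rewrite (_ : [set _ | _] = set0)//; rewrite -subset0 => x /= v0E.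
    by move: v0; rewrite -v0E.
  case: v => [|d v].
    by rewrite (_ : [set _ | _] = set0)// -subset0 => x.
  rewrite (_ : [set _ | _] = [set x | digit x = d] `&`
    T @^-1` [set x | word n x = v]).
    apply: measurableI; first exact: measurable_digit.
    by apply: measurable_Tab; exact: IHn.
  by apply/seteqP; split => x /= [-> ->].
have -> : [set x | Q (word n x)] =
    \bigcup_(v in [set v | Q v]) [set x | word n x = v].
  apply/seteqP; split => x /=; first by exists (word n x).
  by move=> [v Qv /= ->].
by rewrite bigcup_mkcond; apply: countable_bigcupT_measurable => // v; case: ifP.
Qed.

Lemma expr_unbounded (C : R) : exists n, C <= beta ^+ n.
Proof.
have [m q2] := expr_gt2 beta_gt1.
exists (m * (Num.truncn `|C|).+1)%N; rewrite exprM.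
apply: (@le_trans _ _ (Num.truncn `|C|).+1%:R).
  by rewrite (le_trans (ler_norm C))// ltW// truncnS_gt.
apply: (@le_trans _ _ (2 ^+ (Num.truncn `|C|).+1)).
  by rewrite -natrX ler_nat ltnW// ltn_expl.
apply: lerXn2r; rewrite ?nnegrE// ?exprn_ge0// ltW//.
Qed.

End words.

(** * Approximation of partitions by words *)

Section approximation.
Context (R : realType) (alpha beta : R).
Local Notation T := (Tab alpha beta).
Local Notation M := (measurableTypeR R).
Local Notation word := (word alpha beta).

Hypothesis beta_gt1 : 1 < beta.
Let beta_gt0 : 0 < beta. Proof. exact: lt_trans beta_gt1. Qed.

Variable mu : probability M R.
Hypothesis mu01 : mu `[(0 : R), (1 : R)]%classic = 1%E.
Hypothesis inv : invariant_measure (T : M -> M) mu.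

Lemma mu_outside : (mu (~` `[0%R, 1%R]%classic) <= 0)%E.
Proof. by rewrite probability_setC ?mu01 ?subee//; exact: measurable_itv. Qed.

(** Up to arbitrarily small measure, A is a union of cylinders. These sets form a sigma-algebra, and
    proving that it contains the rays amounts to saying that the words generate the Borel sets
    modulo mu. *)
Definition word_approximable (A : set M) := measurable A /\
  forall e : R, 0 < e -> exists m (b : pred (seq int)) (N : set M),
    [/\ measurable N, (mu N <= e%:E)%E & forall x, ~ N x -> A x <-> b (word m x)].

Lemma word_approximableC A : word_approximable A -> word_approximable (~` A).
Proof.
move=> [mA hA]; split; first exact: measurableC.
move=> e /hA[m [b [N [mN Ne h]]]]; exists m, (predC b), N; split => // x /h /= ->.
by split => /negP.
Qed.

Lemma word_approximable0 : word_approximable set0.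
Proof.
split => // e e0; exists 0%N, pred0, set0; split => //.
by rewrite measure0 lee_fin ltW.
Qed.

Lemma word_approximableU A B : word_approximable A -> word_approximable B ->
  word_approximable (A `|` B).
Proof.
move=> [mA hA] [mB hB]; split; first exact: measurableU.
move=> e e0; have e20 : 0 < e / 2 by rewrite divr_gt0.
have [m [b [N [mN Ne h]]]] := hA _ e20.
have [m' [b' [N' [mN' Ne' h']]]] := hB _ e20.
exists (maxn m m'), (fun v => b (take m v) || b' (take m' v)), (N `|` N').
split => [||x /not_orP[/h hx /h' h'x]]; first exact: measurableU.
  apply: le_trans (measureU2 _ _ _) _ => //.
  by rewrite [e]splitr EFinD leeD.
rewrite !take_word ?leq_maxl ?leq_maxr//; split.
  by move=> [/hx ->|/h'x ->]//; rewrite orbT.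
by move=> /orP[/hx|/h'x]; [left|right].
Qed.

(** A finite union already exhausts the countable one up to measure e / 2, so that a single word
    length suffices. *)
Lemma word_approximable_bigcup (A : nat -> set M) :
  (forall n, word_approximable (A n)) -> word_approximable (\bigcup_n A n).
Proof.
move=> hA; have mA n : measurable (A n) by case: (hA n).
have mU : measurable (\bigcup_n A n) by exact: bigcupT_measurable.
split=> // e e0; have e20 : 0 < e / 2 by rewrite divr_gt0.
pose U n := \big[setU/set0]_(i < n) A i.
have UE n x : U n x <-> exists2 i, (i < n)%N & A i x.
  rewrite /U -bigcup_mkord; split => [[i /= ? ?]|[i ? ?]]; by exists i.
have aU n : word_approximable (U n).
  elim: n => [|n IHn]; first by rewrite /U big_ord0; exact: word_approximable0.
  by rewrite /U big_ord_recr; exact: word_approximableU.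
have [|||n hn] := @vanishing_measure _ _ _ mu
    (fun n => \bigcup_n A n `\` U n) _ e20.
- by move=> n; apply: measurableD => //; case: (aU n).
- move=> n x [Ax nU]; split => // /UE[i ni Ai]; apply: nU.
  by apply/UE; exists i => //; exact: ltnW.
- move=> x; have [[i _ Ai]|nA] := pselect ((\bigcup_n A n) x).
    by exists i.+1 => -[_]; apply; apply/UE; exists i.
  by exists 0%N => -[].
have [_ /(_ _ e20)[m [b [N [mN Ne h]]]]] := aU n.
have mD : measurable (\bigcup_n A n `\` U n).
  by apply: measurableD => //; case: (aU n).
exists m, b, (N `|` (\bigcup_n A n `\` U n)); split => [||x].
- exact: measurableU.
- apply: le_trans (measureU2 _ _ _) _ => //.
  by rewrite [e]splitr EFinD leeD.
move=> /not_orP[/h hx nD]; split; last by move=> /hx/UE[i _ Ai]; exists i.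
by move=> Ax; apply/hx; apply: contrapT => nU; apply: nD.
Qed.

(** Points of [0, 1] with the same n-word are within beta^-n of each other, so only points of [a -
    beta^-n, a) can be misclassified, and the mass of this interval tends to 0. *)
Lemma word_approximable_ray a : word_approximable `[a, +oo[%classic.
Proof.
split; first exact: measurable_itv.
move=> e e0.
pose F n : set M := `[a - (beta ^+ n)^-1, a[%classic.
have [|n x|x|n hn] := @vanishing_measure _ _ _ mu F _ e0.
- by move=> n; exact: measurable_itv.
- rewrite /F /= !in_itv/= => /andP[xa ->]; rewrite andbT (le_trans _ xa)//.
  by rewrite lerD2l lerN2 lef_pV2 ?posrE ?exprn_gt0// ler_eXn2l.
- have [ax|xa] := leP a x.
    by exists 0%N; rewrite /F/= in_itv/= => /andP[_]; rewrite ltNge ax.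
  have [n hn] := expr_unbounded beta_gt1 ((a - x)^-1 + 1).
  exists n; rewrite /F/= in_itv/= => /andP[+ _]; apply/negP; rewrite -ltNge.
  rewrite ltrBrDr -ltrBrDl -[ltRHS]invrK ltf_pV2 ?posrE ?exprn_gt0 ?invr_gt0//.
    lra.
  by rewrite subr_gt0.
pose b v := `[< exists y, [/\ 0 <= y <= 1, a <= y & word n y = v] >].
exists n, b, (~` `[0, 1] `|` F n); split.
- by apply: measurableU; [apply: measurableC|]; exact: measurable_itv.
- apply: le_trans (measureU2 _ _ _) _; [apply: measurableC| |];
    try exact: measurable_itv.
  by rewrite -[leRHS]add0e; apply: leeD => //; exact: mu_outside.
move=> x /not_orP[/contrapT/=]; rewrite !in_itv/= andbT => x01 nF.
split; first by move=> ax; apply/asboolP; exists x.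
move=> /asboolP[y [y01 ay yx]]; rewrite leNgt; apply/negP => xa.
apply: nF; rewrite /F/= in_itv/= xa andbT.
have := word_dist beta_gt1 y01 x01 yx; rewrite ger0_norm; lra.
Qed.

Lemma measurable_word_approximable (A : set M) :
  measurable A -> word_approximable A.
Proof.
have -> : (measurable : set (set M)) = (@RGenCInfty.G R).-sigma.-measurable.
  exact: RGenCInfty.measurableE.
suff : (@RGenCInfty.G R).-sigma.-measurable `<=` (word_approximable : set (set R)).
  by apply.
apply: smallest_sub.
  split; first exact: word_approximable0.
  - by move=> B aB; rewrite setTD; exact: word_approximableC.
  - exact: word_approximable_bigcup.
by move=> _ [x ->]; exact: word_approximable_ray.
Qed.

Variables (k : nat) (xi : M -> 'I_k).
Hypothesis mxi : measurable_partition xi.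

Lemma measurable_mismatch m (phi : seq int -> 'I_k) :
  measurable [set x | phi (word m x) != xi x].
Proof.
rewrite (_ : [set _ | _] = \bigcup_(i in [set: 'I_k])
    ([set x | phi (word m x) = i] `&` ~` (xi @^-1` [set i]))).
  apply: fin_bigcup_measurable => // i _; apply: measurableI.
    exact: (measurable_word _ _ _ (fun v => phi v = i)).
  by apply: measurableC; exact: mxi.
apply/seteqP; split => x /=; first by move=> /eqP/nesym ?; exists (phi (word m x)).
by move=> [i _ [/= -> /nesym/eqP]].
Qed.

Lemma partition_approximable (del : R) : 0 < del ->
  exists m (phi : seq int -> 'I_k),
    (mu [set x | phi (word m x) != xi x] <= del%:E)%E.
Proof.
move=> del0; have k0 : (0 < k)%N by exact: leq_ltn_trans (ltn_ord (xi 0)).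
have ek : 0 < del / k%:R by rewrite divr_gt0// ltr0n.
have /choice[f hf] : forall i : 'I_k, exists t : nat * pred (seq int) * set M,
    [/\ measurable t.2, (mu t.2 <= (del / k%:R)%:E)%E &
      forall x, ~ t.2 x -> xi x = i <-> t.1.2 (word t.1.1 x)].
  move=> i; have [_ /(_ _ ek)[m [b [N h]]]] := measurable_word_approximable (mxi i).
  by exists (m, b, N).
pose m := \max_(i < k) (f i).1.1.
have fm i : ((f i).1.1 <= m)%N by exact: leq_bigmax.
(* Outside the union N of the exceptional sets, exactly one index is accepted, namely the cell of x;
   the default value can occur only on N. *)
pose phi v : 'I_k := odflt (xi 0) [pick i | (f i).1.2 (take (f i).1.1 v)].
exists m, phi; pose N := \big[setU/set0]_(i < k) (f i).2.
have [mN muN] : measurable N /\ (mu N <= \sum_(i < k) mu (f i).2)%E.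
  apply: (big_ind2 (fun A r => measurable A /\ (mu A <= r)%E)) => [|A r B t|i _].
  - by rewrite measure0.
  - move=> [mA Ar] [mB Bt]; split; first exact: measurableU.
    by apply: le_trans (measureU2 _ _ _) _ => //; exact: leeD.
  - by case: (hf i).
apply: (@le_trans _ _ (mu N)).
  apply: le_measure; rewrite ?inE//; first exact: measurable_mismatch.
  move=> x /= ne; apply: contrapT => nN; move/eqP: ne; apply.
  have fx i : xi x = i <-> (f i).1.2 (take (f i).1.1 (word m x)).
    rewrite take_word//; have [_ _] := hf i; apply => Nx; apply: nN.
    by rewrite /N (bigD1 i)//=; left.
  rewrite /phi; case: pickP => [i /fx <-//|/(_ (xi x))].
  by have /fx -> := erefl (xi x).
apply: le_trans muN _.
apply: (@le_trans _ _ (\sum_(i < k) (del / k%:R)%:E)%E).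
  by apply: lee_sum => i _; case: (hf i).
rewrite sumEFin sumr_const card_ord lee_fin -[leLHS]mulr_natr divfK//.
by rewrite pnatr_eq0 -lt0n.
Qed.

Lemma join_entropy_eventually_le (C b : R) : 1 <= C -> 1 <= b ->
    (forall n, exists2 s : seq (seq int), (size s)%:R <= C * b ^+ n &
       mu.-negligible [set x | word n x \notin s]) ->
  forall h, 0 < h ->
  \forall n \near \oo, join_entropy (T : M -> M) mu xi n / n%:R <= ln b + h.
Proof.
move=> C1 b1 hs h h0; have k0 : (0 < k)%N by exact: leq_ltn_trans (ltn_ord (xi 0)).
have b0 : 0 < b by exact: lt_le_trans b1.
have C0 : 0 < C by exact: lt_le_trans C1.
(* The error h is shared equally between - ln (1 - e), the mismatches of probability del, and the
   constant L divided by n. *)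
pose e := 1 - expR (- (h / 3)).
have h3 : 0 < h / 3 by rewrite divr_gt0.
have e01 : 0 < e < 1.
  by rewrite subr_gt0 expR_lt1 oppr_lt0 h3/= ltrBlDr ltrDl expR_gt0.
have le1 : - ln (1 - e) = h / 3 by rewrite /e subKr expRK opprK.
have lke : 0 <= ln (k%:R / e).
  case/andP: e01 => e0 e1.
  by rewrite ln_ge0// ler_pdivlMr// mul1r (le_trans (ltW e1))// ler1n.
pose del := h / 3 / (ln (k%:R / e) + 1).
have lke1 : 0 < ln (k%:R / e) + 1 by rewrite ltr_wpDl.
have del0 : 0 < del by rewrite divr_gt0.
have dell : del * ln (k%:R / e) <= h / 3.
  by rewrite /del mulrAC ler_pdivrMr// ler_pM2l// lerDl.
have [m [phi hphi]] := partition_approximable del0.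
pose L := ln C + m%:R * ln b.
have lb0 : 0 <= ln b by exact: ln_ge0.
near=> n.
have n0 : 0 < n%:R :> R by rewrite ltr0n; near: n; exists 1%N.
have Ln : L <= n%:R * (h / 3).
  rewrite -ler_pdivrMr//; near: n; exact: nbhs_infty_ger.
have [s sK ns] := hs (n + m)%N.
(* A code of length n + m contains the m-word of each of the first n iterates, from which the cell
   of that iterate is predicted. *)
have shift (i : 'I_n) x : take m (drop i (word (n + m) x)) = word m (iter i T x).
  have -> : (n + m = i + (n - i + m))%N by rewrite addnA subnKC// ltnW.
  by rewrite wordD drop_size_cat ?size_word// take_word// leq_addl.
have shiftE (i : 'I_n) :
    [set x | phi (take m (drop i (word (n + m) x))) != xi (iter i T x)] =
    iter i T @^-1` [set x | phi (word m x) != xi x].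
  by apply/seteqP; split => x /=; rewrite shift.
have mT := @measurable_Tab R alpha beta beta_gt1.
have mm (i : 'I_n) : measurable
    [set x : M | phi (take m (drop i (word (n + m) x))) != xi (iter i T x)].
  rewrite shiftE; apply: (measurable_iter_preimage mT).
  exact: measurable_mismatch.
have mdel (i : 'I_n) : (mu
    [set x | phi (take m (drop i (word (n + m) x))) != xi (iter i T x)]
    <= del%:E)%E.
  by rewrite shiftE (invariant_iter mT inv)//; exact: measurable_mismatch.
have H := @join_entropy_le _ M R T mu mT k xi mxi n _ (word (n + m))
  (fun i v => phi (take m (drop i v))) s del e e01 ns mm mdel.
rewrite ler_pdivrMr//; apply: (le_trans H).
have lns : ln (size s)%:R <= ln C + (n + m)%:R * ln b.
  have [s0|s0] := posnP (size s).
    by rewrite s0 ln0// addr_ge0 ?ln_ge0// mulr_ge0.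
  apply: (@le_trans _ _ (ln (C * b ^+ (n + m)))).
    by rewrite ler_ln ?posrE ?ltr0n// mulr_gt0// exprn_gt0.
  by rewrite lnM ?posrE ?exprn_gt0// lnXn// mulr_natl.
have := ler_wpM2l (ltW n0) dell.
rewrite le1; move: lns Ln; rewrite /L natrD; lra.
Unshelve. all: by end_near. Qed.

End approximation.

(** * Distortion of Lebesgue measure *)

(** Uniqueness of Lebesgue measure reduces the claim to half-open intervals. *)
Lemma lebesgue_measure_affine (R : realType) (q s : R)
    (A : set (measurableTypeR R)) : 0 < q -> measurable A ->
  (lebesgue_measure A =
     q%:E * lebesgue_measure ((fun x => (q * x + s)%R) @^-1` A))%E.
Proof.
move=> q0 mA; pose f (x : measurableTypeR R) : measurableTypeR R := q * x + s.
have mf : measurable_fun setT f by exact: measurable_affine.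
apply: (@lebesgue_measure_unique R
  (mscale (NngNum (ltW q0)) (pushforward lebesgue_measure f))) => // _ [[a b]] _ <-.
rewrite [RHS](_ : _ = q%:E * lebesgue_measure (f @^-1` `]a, b]%classic))%E//.
rewrite (_ : f @^-1` _ = `](a - s) / q, (b - s) / q]%classic); last first.
  apply/seteqP; split => x /=; rewrite !in_itv/= /f ltr_pdivrMr// ler_pdivlMr//;
    by rewrite ltrBlDr lerBrDr [x * q]mulrC.
rewrite !lebesgue_measure_itv/= !lte_fin ltr_pM2r ?invr_gt0// ltrD2r.
case: ifP => _; last by rewrite mule0.
by rewrite -!EFinD -EFinM; congr (_%:E); field; rewrite gt_eqF.
Qed.

Definition unit_lebesgue (R : realType) : set (measurableTypeR R) -> \bar R :=
  mrestr lebesgue_measure (measurable_itv `[0%R, 1%R[).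

HB.instance Definition _ (R : realType) := Measure.on (@unit_lebesgue R).

Lemma unit_lebesgue_setT (R : realType) : @unit_lebesgue R setT = 1%E.
Proof.
rewrite /unit_lebesgue /mrestr setTI lebesgue_measure_itv/=.
by rewrite lte_fin ltr01 oppr0 adde0.
Qed.

HB.instance Definition _ (R : realType) :=
  Measure_isProbability.Build _ _ _ (@unit_lebesgue R) (unit_lebesgue_setT R).

(** Compactness gives a cluster point, and an ultrafilter converges to its cluster points. *)
Lemma ultra_cvg_segment (R : realType) (U : set_system nat) (a : nat -> R)
    (x y : R) : UltraFilter U -> (forall n, x <= a n <= y) ->
  exists l : R, a n @[n --> U] --> l.
Proof.
move=> UU axy.
have [|l [_ cl]] := @segment_compact R x y (fmap a U) _.
  by rewrite /fmap/=; apply: (@filterE _ U) => n /=; rewrite in_itv/=; exact: axy.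
exists l => V /= lV; have [//|UV] := in_ultra_setVsetC (a @^-1` V) UU.
by have [z []] := cl _ _ (UV : fmap a U (~` V)) lV.
Qed.

Section bounded_distortion.
Context (R : realType) (alpha beta : R).
Local Notation T := (Tab alpha beta).
Local Notation M := (measurableTypeR R).
Local Notation word := (word alpha beta).
Local Notation lam := (@unit_lebesgue R).

Hypothesis beta_gt1 : 1 < beta.
Let beta_gt0 : 0 < beta. Proof. exact: lt_trans beta_gt1. Qed.

Let mT : forall A : set M, measurable A -> measurable (T @^-1` A).
Proof. by move=> A; exact: measurable_Tab. Qed.

Lemma unit_lebesgueI (A B : set M) :
  A `&` `[0, 1[ = B `&` `[0, 1[ -> lam A = lam B.
Proof. by rewrite /unit_lebesgue /mrestr => ->. Qed.

(** Change of variables: on a cylinder of length n the iterate is a single affine map of slope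
    beta^n. *)
Lemma unit_lebesgue_cylinder n v (A : set M) : measurable A ->
  fine (lam (iter n T @^-1` A `&` [set x | word n x = v]))
    <= (beta ^+ n)^-1 * fine (lam A).
Proof.
move=> mA; have q0 : 0 < beta ^+ n by exact: exprn_gt0.
have mAI : measurable (A `&` `[0, 1[ : set M).
  by apply: measurableI => //; exact: measurable_itv.
set D := _ `&` _.
have mD : measurable D.
  apply: measurableI; first exact: measurable_iter_preimage.
  exact: (measurable_word alpha beta_gt1 _ (fun w => w = v)).
have [[x0 [Dx0 _]]|D0] := pselect ((D `&` `[0, 1[) !=set0); last first.
  rewrite (@unit_lebesgueI D set0) ?measure0 ?mulr_ge0 ?invr_ge0 ?(ltW q0)//.
  - exact: fine_probability_ge0.
  - rewrite set0I -subset0 => x Dx; apply: D0; by exists x.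
pose s := iter n T x0 - beta ^+ n * x0.
have Ts x : D x -> iter n T x = beta ^+ n * x + s.
  case: Dx0 => _ /= w0 [_ /= wx]; rewrite (iter_Tab_affine (etrans w0 (esym wx))).
  by rewrite /s; ring.
have mpre : measurable ((fun x : M => beta ^+ n * x + s : M) @^-1` (A `&` `[0, 1[)).
  by rewrite -[_ @^-1` _]setTI; exact: measurable_affine.
rewrite -ler_pdivrMl ?invr_gt0// invrK.
rewrite -lee_fin EFinM !fineK ?fin_num_measure//.
rewrite [leRHS](lebesgue_measure_affine s q0 mAI) lee_pmul2l//.
apply: le_measure; rewrite ?inE//.
  by apply: measurableI => //; exact: measurable_itv.
move=> x [Dx x01] /=; rewrite -Ts//; case: (Dx) => /= Ax _; split => //.
move: x01; rewrite /= !in_itv/= => /andP[x0' x1].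
have x01 : 0 <= x <= 1 by rewrite x0' ltW.
by rewrite iter_Tab_lt1// andbT; case/andP: (iter_Tab_itv01 alpha beta n x01).
Qed.

(** There are O(beta^n) cylinders and each contributes at most beta^-n times the measure of A; the
    powers cancel, so C does not depend on n. *)
Lemma unit_lebesgue_iter : exists2 C, 0 < C & forall n (A : set M),
  measurable A -> fine (lam (iter n T @^-1` A)) <= C * fine (lam A).
Proof.
have [C C0 hC] := few_words alpha beta_gt1; exists C => // n A mA.
have q0 : 0 < beta ^+ n by exact: exprn_gt0.
have [s sC hs] := hC n.
have mI : measurable (iter n T @^-1` A) by exact: measurable_iter_preimage.
have mW (Q : seq int -> Prop) :
    measurable (iter n T @^-1` A `&` [set x | Q (word n x)] : set M).
  by apply: measurableI => //; exact: (measurable_word alpha beta_gt1).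
have -> : lam (iter n T @^-1` A) =
    lam (iter n T @^-1` A `&` [set x | word n x \in s]).
  apply: unit_lebesgueI; rewrite -setIA; congr (_ `&` _); apply/seteqP.
  by split => [x x01|x []//]; split => //; exact: hs.
apply: (@le_trans _ _ ((size s)%:R * ((beta ^+ n)^-1 * fine (lam A)))); last first.
  rewrite mulrA ler_wpM2r ?fine_probability_ge0//.
  by rewrite ler_pdivrMr.
elim: (s) => [|v t IHt].
  rewrite (_ : _ `&` _ = set0) ?measure0 ?mul0r//.
  by rewrite -subset0 => x [].
rewrite /= -add1n natrD mulrDl mul1r.
apply: le_trans (lerD (unit_lebesgue_cylinder n v mA) IHt).
have mv := mW (fun w => w = v); have mt := mW (fun w => w \in t).
have mvt := mW (fun w => w \in v :: t).
rewrite -fineD ?fin_num_measure// fine_le ?fin_num_measure//.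
  by rewrite fin_numD !fin_num_measure.
apply: (le_trans _ (measureU2 _ mv mt)).
apply: le_measure; rewrite ?inE//; first exact: measurableU.
by move=> x [Ax /=]; rewrite inE => /predU1P[->|xt]; [left|right].
Qed.

End bounded_distortion.

(** * An invariant measure with bounded density *)

(** What a countable union leaves after k terms has n-mass at most C times its P-mass, which tends
    to 0; this turns finite additivity into countable additivity. *)
Lemma dominated_probability (d : measure_display) (X : measurableType d)
    (R : realType) (P : probability X R) (n : set X -> R) (C : R) :
  (forall A, 0 <= n A) ->
  (forall A B, measurable A -> measurable B -> A `&` B = set0 ->
     n (A `|` B) = n A + n B) ->
  (forall A, measurable A -> n A <= C * fine (P A)) -> n setT = 1 ->
  exists Q : probability X R, forall A, Q A = (n A)%:E.
Proof.
move=> n0 nU nP nT; pose m (A : set X) := (n A)%:E.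
have m0 : m set0 = 0%E.
  have := nU _ _ measurable0 measurable0 (setI0 set0); rewrite setU0 /m => h.
  by congr (_%:E); move: h; lra.
have m_ge0 A : (0 <= m A)%E by rewrite lee_fin.
have m_sigma : semi_sigma_additive m.
  move=> F mF tF mUF; pose U k := \big[setU/set0]_(i < k) F i.
  have mU k : measurable (U k) by apply: bigsetU_measurable => i _.
  have UF k : U k `<=` \bigcup_i F i.
    by rewrite /U -bigcup_mkord => x [i _ Fix]; exists i.
  have sumE k : (\sum_(0 <= i < k) m (F i))%E = (n (U k))%:E.
    elim: k => [|k IHk]; first by rewrite big_nil /U big_ord0 -/(m set0) m0.
    have UFk : U k `&` F k = set0.
      rewrite /U -bigcup_mkord -subset0 => x [[i /= ik Fix] Fkx].
      have : (F i `&` F k) x by [].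
      by have /trivIsetP -> := tF; rewrite // lt_eqF.
    by rewrite big_nat_recr//= IHk [U k.+1]big_ord_recr/= -/(U k) nU.
  have split_n k : n (\bigcup_i F i) = n (U k) + n (\bigcup_i F i `\` U k).
    rewrite -nU//; [|exact: measurableD|by rewrite setDE setICA setICr setI0].
    by rewrite setDE setUIr setUv setIT; congr n; apply/esym/setUidPr; exact: UF.
  under eq_fun do rewrite sumE.
  apply/fine_cvgP; split; first exact: nearW.
  rewrite /comp/=.
  have cvP : fine (P (U k)) @[k --> \oo] --> fine (P (\bigcup_i F i)).
    apply: fine_cvg; rewrite fineK ?fin_num_measure//.
    rewrite (_ : \bigcup_i F i = \bigcup_k U k); last first.
      apply/seteqP; split => x; last by move=> [k _ /UF].
      by move=> [i _ Fix]; exists i.+1 => //; rewrite /U big_ord_recr; right.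
    apply: nondecreasing_cvg_mu => //; first exact: bigcup_measurable.
    by move=> i j ij; apply/subsetPset; exact: subset_bigsetU.
  apply: (@squeeze_cvgr _ _ _ _ (fun k => n (\bigcup_i F i)
     - C * (fine (P (\bigcup_i F i)) - fine (P (U k)))) (fun=> n (\bigcup_i F i))).
  - apply: nearW => k; apply/andP; split; last by rewrite (split_n k) lerDl.
    rewrite lerBlDr {1}(split_n k) lerD2l.
    apply: le_trans (nP _ (measurableD mUF (mU k))) _.
    rewrite -fineB ?fin_num_measure// measureD//.
      by rewrite (setIidr (UF k)).
    by rewrite -ge0_fin_numE ?measure_ge0// fin_num_measure.
  - rewrite -[X in _ --> X]subr0 -[X in _ --> _ - X](mulr0 C).
    rewrite -(subrr (fine (P (\bigcup_i F i)))).
    apply: cvgB; first exact: cvg_cst.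
    apply: cvgM; first exact: cvg_cst.
    by apply: cvgB => //; exact: cvg_cst.
  - exact: cvg_cst.
pose mM := isMeasure.Build _ _ _ m m0 m_ge0 m_sigma.
pose pM : measure X R := HB.pack_for (measure X R) m mM.
have pT : pM setT = 1%E by rewrite /= /m nT.
pose pP := @Measure_isProbability.Build _ X R pM pT.
pose Q : probability X R := HB.pack_for (probability X R) m mM pP.
by exists Q.
Qed.

Section invariant_density.
Context (R : realType) (alpha beta : R).
Local Notation T := (Tab alpha beta).
Local Notation M := (measurableTypeR R).
Local Notation lam := (@unit_lebesgue R).

Hypothesis beta_gt1 : 1 < beta.

Let mT : forall A : set M, measurable A -> measurable (T @^-1` A).
Proof. by move=> A; exact: measurable_Tab. Qed.

Definition average_pushforward n (A : set M) : R :=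
  n%:R^-1 * \sum_(i < n) fine (lam (iter i T @^-1` A)).

Local Notation avg := average_pushforward.

Lemma average_pushforward_ge0 n A : 0 <= avg n A.
Proof.
by rewrite mulr_ge0 ?invr_ge0 ?sumr_ge0// => i _; exact: fine_probability_ge0.
Qed.

Lemma average_pushforward_le n (A : set M) (c : R) : 0 <= c ->
  (forall i, fine (lam (iter i T @^-1` A)) <= c) -> avg n A <= c.
Proof.
case: n => [c0 _|n _ h]; first by rewrite /avg invr0 mul0r.
rewrite /avg ler_pdivrMl//; apply: (@le_trans _ _ (\sum_(i < n.+1) c)).
  exact: ler_sum.
by rewrite sumr_const card_ord mulr_natl.
Qed.

(** The difference of the two sums telescopes to its end terms, both in [0, 1]. *)
Lemma average_pushforward_Tab n (A : set M) : measurable A ->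
  `|avg n (T @^-1` A) - avg n A| <= n%:R^-1.
Proof.
move=> mA; rewrite /avg -mulrBr normrM ger0_norm ?invr_ge0// ler_piMr ?invr_ge0//.
pose a i := fine (lam (iter i T @^-1` A)).
have -> : \sum_(i < n) fine (lam (iter i T @^-1` (T @^-1` A))) =
    \sum_(i < n) a i.+1.
  by [].
have a01 i : 0 <= a i <= 1.
  rewrite fine_probability_ge0/= -(fine_probability_setT lam).
  by apply: fine_probability_le => //; exact: measurable_iter_preimage.
have -> : \sum_(i < n) a i.+1 - \sum_(i < n) a i = a n - a 0%N.
  elim: n => [|n IHn]; first by rewrite !big_ord0 !subrr.
  by rewrite !big_ord_recr/=; lra.
by have := a01 n; have := a01 0%N; rewrite ler_norml; lra.
Qed.

(* The limit along an ultrafilter of the averages of the pushforwards of Lebesgue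
   measure is only finitely additive; the domination by Lebesgue measure makes
   it a measure. *)
Lemma bounded_invariant_probability : exists2 C, 0 < C &
  exists nu : probability M R, invariant_probability T nu /\
    forall A : set M, measurable A -> fine (nu A) <= C * fine (lam A).
Proof.
have [C C0 hC] := unit_lebesgue_iter alpha beta_gt1; exists C => //.
have [U [UU Uoo]] := @ultraFilterLemma nat \oo _.
pose N (A : set M) : R := lim (avg n A @[n --> U]).
have cvN A : measurable A -> avg n A @[n --> U] --> N A.
  move=> mA; have [|l al] := @ultra_cvg_segment R U (avg^~ A) 0 1 UU.
    move=> n; rewrite average_pushforward_ge0/=.
    apply: average_pushforward_le => // i; rewrite -(fine_probability_setT lam).
    by apply: fine_probability_le => //; exact: measurable_iter_preimage.
  by rewrite /N (cvg_lim _ al).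
(* This covers all sets, measurable or not: where the averages diverge along U, [lim] has the
   default value 0. *)
have N0 A : 0 <= N A.
  rewrite /N; have [cv|dv] := pselect (cvg (avg n A @[n --> U])).
    by apply: limr_ge => //; apply: nearW => n; exact: average_pushforward_ge0.
  by rewrite dvgP.
have NU A B : measurable A -> measurable B -> A `&` B = set0 ->
    N (A `|` B) = N A + N B.
  move=> mA mB AB; apply: cvg_lim => //.
  have -> : avg^~ (A `|` B) = avg^~ A \+ avg^~ B.
    apply/funext => n /=; rewrite /avg -mulrDr -big_split/=; congr (_ * _).
    apply: eq_bigr => i _; rewrite preimage_setU measureU.
    - by rewrite fineD// fin_num_measure//; exact: measurable_iter_preimage.
    - exact: measurable_iter_preimage.
    - exact: measurable_iter_preimage.
    - by rewrite -preimage_setI AB preimage_set0.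
  by apply: cvgD; exact: cvN.
have NC A : measurable A -> N A <= C * fine (lam A).
  move=> mA; apply: (ler_cvg_to (cvN A mA) (cvg_cst (C * fine (lam A)))).
  apply: nearW => n; apply: average_pushforward_le => [|i]; last exact: hC.
  by rewrite mulr_ge0 ?(ltW C0)// fine_probability_ge0.
have full A : `[0%R, 1%R] `<=` A -> N A = 1.
  move=> A01; apply: cvg_lim => //.
  have avg1 : \forall n \near U, 1 = avg n A.
    apply: Uoo; exists 1%N => // -[//|n] _ /=.
    rewrite /avg (eq_bigr (fun=> 1)) => [|i _].
      by rewrite sumr_const card_ord mulVf// pnatr_eq0.
    rewrite (@unit_lebesgueI _ _ setT) ?fine_probability_setT//.
    rewrite setTI; apply/seteqP; split => [x []//|x x01]; split => //=.
    apply: A01; rewrite /= in_itv/=; apply: iter_Tab_itv01.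
    by move: x01; rewrite /= in_itv/= => /andP[-> /ltW].
  exact: cvg_trans (near_eq_cvg avg1) (cvg_cst _).
have [nu nuE] := dominated_probability N0 NU NC (full _ (@subsetT _ _)).
exists nu; split; last by move=> A mA; rewrite nuE; exact: NC.
split=> [|A mA]; first by rewrite nuE full.
rewrite !nuE; congr (_%:E); apply/eqP; rewrite -subr_eq0 -normr_le0.
have cvd : `|avg n (T @^-1` A) - avg n A| @[n --> U] --> `|N (T @^-1` A) - N A|.
  by apply: cvg_norm; apply: cvgB; apply: cvN => //; exact: mT.
have cv0 : n%:R^-1 @[n --> U] --> (0 : R).
  have h : (n%:R^-1 : R) @[n --> \oo] --> (0 : R).
    by rewrite -(cvg_shiftS _); exact: cvg_harmonic.
  by move=> V V0; apply: Uoo; exact: h.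
by apply: (ler_cvg_to cvd cv0); apply: nearW => n; exact: average_pushforward_Tab.
Qed.

End invariant_density.

(** * Entropy bounds *)

Section entropy_bounds.
Context (R : realType) (alpha beta : R).
Local Notation T := (Tab alpha beta).
Local Notation M := (measurableTypeR R).
Local Notation word := (word alpha beta).
Local Notation digit := (digit alpha beta).
Local Notation lam := (@unit_lebesgue R).

Hypothesis beta_gt1 : 1 < beta.

Lemma entropy_le (mu : probability M R) (C b : R) :
    invariant_probability T mu -> 1 <= b ->
    (forall n, exists2 s : seq (seq int), (size s)%:R <= C * b ^+ n &
       mu.-negligible [set x | word n x \notin s]) ->
  (entropy (T : M -> M) mu <= (ln b)%:E)%E.
Proof.
move=> [mu01 inv] b1 hs; apply: ge_ereal_sup => _ [k [xi [mxi ->]]].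
rewrite lee_fin /partition_entropy; set a := (X in limn X).
(* In the absence of a limit, [limn] has the junk value 0. *)
have [cv|dv] := pselect (cvgn a); last by rewrite dvgP// ln_ge0.
apply/ler_addgt0Pr => h h0; apply: limr_le => //.
have C1 : 1 <= Num.max 1 C by rewrite le_max lexx.
apply: (join_entropy_eventually_le beta_gt1 mu01 inv mxi C1 b1 _ h0) => n.
have [s sC ns] := hs n; exists s => //; apply: le_trans sC _.
by rewrite ler_wpM2r ?exprn_ge0 ?(le_trans ler01 b1)// le_max lexx orbT.
Qed.

Hypothesis alpha_ge0 : 0 <= alpha.
Let beta_gt0 : 0 < beta. Proof. exact: lt_trans beta_gt1. Qed.

(** On [0, 1) the digits are natural numbers at most D, so [xi] is the partition into branches of
    T. *)
Let D : nat := Num.truncn (alpha + beta).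

Let xi (x : M) : 'I_D.+1 := inord `|digit x|%N.

Let measurable_xi : measurable_partition xi.
Proof.
move=> i; rewrite (_ : xi @^-1` _ = [set x | inord `|head 0%R (word 1 x)|%N = i])//.
exact: (measurable_word alpha beta_gt1 1 (fun v => inord `|head 0%R v|%N = i)).
Qed.

Let xi_inj x y : 0 <= x < 1 -> 0 <= y < 1 -> xi x = xi y -> digit x = digit y.
Proof.
have dig z : 0 <= z < 1 -> exists2 d : nat, digit z = d & (d < D.+1)%N.
  move=> /andP[z0 z1]; rewrite /digit lt_eqF//.
  have z_ge0 : 0 <= beta * z + alpha by rewrite addr_ge0 ?mulr_ge0// ltW.
  exists (Num.truncn (beta * z + alpha)).
    by rewrite truncn_floor z_ge0 gez0_abs// floor_ge0.
  by rewrite ltnS le_truncn// addrC lerD2l ler_piMr ?(ltW beta_gt0)// ltW.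
move=> /dig[d xd dD] /dig[e ye eD]; rewrite /xi xd ye /= => /(congr1 val) /=.
by rewrite !inordK// => ->.
Qed.

Let xi_word n x y : 0 <= x < 1 -> 0 <= y < 1 ->
  (forall i : 'I_n, xi (iter i T x) = xi (iter i T y)) -> word n x = word n y.
Proof.
have it i z : 0 <= z < 1 -> 0 <= iter i T z < 1.
  move=> /andP[z0 z1]; rewrite iter_Tab_lt1// andbT.
  by have /andP[] : 0 <= iter i T z <= 1 by apply: iter_Tab_itv01; rewrite z0 ltW.
move=> x01 y01 h; apply: (@eq_from_nth _ 0) => [|i]; rewrite !size_word// => ni.
rewrite !nth_word//; apply: xi_inj; [exact: it|exact: it|].
exact: (h (Ordinal ni)).
Qed.

(** Every cell of the n-fold join has mass at most C * beta^-n, so its information is at least n *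
    ln beta - ln C. *)
Lemma entropy_ge (nu : probability M R) (C : R) : 0 < C ->
    invariant_probability T nu ->
    (forall A : set M, measurable A -> fine (nu A) <= C * fine (lam A)) ->
  ((ln beta)%:E <= entropy (T : M -> M) nu)%E.
Proof.
move=> C0 [nu01 inv] nuC.
have low n : n%:R * ln beta - ln C <= join_entropy (T : M -> M) nu xi n.
  have q0 : 0 < beta ^+ n by rewrite exprn_gt0.
  pose Y (x : M) : {ffun 'I_n -> 'I_D.+1} := [ffun i : 'I_n => xi (iter i T x)].
  have YE (w : {ffun 'I_n -> 'I_D.+1}) :
      [set x : M | forall i : 'I_n, xi (iter i T x) = w i] = Y @^-1` [set w].
    apply/seteqP; split => x /= h; first by apply/ffunP => i; rewrite ffunE.
    by move=> i; rewrite -h ffunE.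
  have mY w : measurable (Y @^-1` [set w]).
    rewrite -YE (_ : [set _ | _] = \bigcap_(i in [set: 'I_n])
        (iter i T @^-1` (xi @^-1` [set w i]))).
      apply: fin_bigcap_measurable => // i _.
      apply: measurable_iter_preimage; last exact: measurable_xi.
      by move=> A; exact: measurable_Tab.
    by apply/seteqP; split => x /= h i; [move=> _; exact: h|exact: (h i Logic.I)].
  have p1 : \sum_w fine (nu (Y @^-1` [set w])) = 1.
    rewrite -(fine_probability_finite_valued nu mY predT).
    rewrite -[RHS](fine_probability_setT nu).
    by congr (fine (nu _)); apply/seteqP; split.
  have pC w : fine (nu (Y @^-1` [set w])) <= C * (beta ^+ n)^-1.
    apply: le_trans (nuC _ (mY w)) _; rewrite ler_pM2l//.
    have [[x0 [Yx0 x001]]|N0] :=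
        pselect ((Y @^-1` [set w] `&` `[0, 1[) !=set0); last first.
      rewrite (@unit_lebesgueI _ _ set0) ?measure0 ?invr_ge0 ?ltW// set0I -subset0.
      by move=> x Yx; apply: N0; exists x.
    have := unit_lebesgue_cylinder alpha beta_gt1 n (word n x0) (@measurableT _ M).
    rewrite fine_probability_setT mulr1; apply: le_trans.
    rewrite (@unit_lebesgueI _ _ (Y @^-1` [set w] `&` `[0, 1[));
      last by rewrite -setIA setIid.
    apply: fine_probability_le.
    - by apply: measurableI; [exact: mY|exact: measurable_itv].
    - apply: measurableI; first exact: measurableT.
      exact: (measurable_word alpha beta_gt1 n (fun v => v = word n x0)).
    move=> x [Yx x01]; split => //=.
    move: x01 x001; rewrite /= !in_itv/= => x01 x001.
    apply: xi_word => // i; move: Yx Yx0 => /= <- /esym/ffunP/(_ i).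
    by rewrite !ffunE.
  have -> : n%:R * ln beta - ln C =
      \sum_w (n%:R * ln beta - ln C) * fine (nu (Y @^-1` [set w])).
    by rewrite -mulr_sumr p1 mulr1.
  apply: ler_sum => w _ /=.
  rewrite YE; set p := fine _; have p0 : 0 <= p by exact: fine_probability_ge0.
  have : p <= C * (beta ^+ n)^-1 by exact: pC.
  move: p0; rewrite le_eqVlt => /predU1P[<- _|p0 pc].
    by rewrite mul0r mulr0 oppr0.
  rewrite mulrC -mulrN ler_pM2l// lerNr.
  apply: (@le_trans _ _ (ln (C * (beta ^+ n)^-1))).
    by rewrite ler_ln// ?posrE ?mulr_gt0// invr_gt0.
  by rewrite lnM ?posrE ?invr_gt0// lnV ?posrE// lnXn// mulr_natl opprB.
have m01 : measurable (~` `[0, 1[ : set M).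
  by apply: measurableC; exact: measurable_itv.
have nuout : nu (~` `[0, 1[) = 0%E.
  apply/eqP; rewrite -fine_eq0 ?fin_num_measure// eq_le fine_probability_ge0 andbT.
  apply: le_trans (nuC _ m01) _; rewrite (@unit_lebesgueI _ _ set0).
    by rewrite measure0 mulr0.
  by rewrite setICl set0I.
(* A lower bound on the sequence says nothing about [limn] unless it converges; the count of words
   at slope beta supplies the matching upper bound. *)
suff cv : join_entropy (T : M -> M) nu xi n / n%:R @[n --> \oo] --> ln beta.
  apply: ereal_sup_ubound; exists D.+1, xi; split; first exact: measurable_xi.
  by rewrite /partition_entropy (cvg_lim _ cv).
have [K K0 hK] := few_words alpha beta_gt1.
have K1 : 1 <= Num.max 1 K by rewrite le_max lexx.
apply/cvgrPdist_le => h h0.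
have up : \forall n \near \oo,
    join_entropy (T : M -> M) nu xi n / n%:R <= ln beta + h.
  apply: (join_entropy_eventually_le beta_gt1 nu01 inv measurable_xi K1
    (ltW beta_gt1) _ h0) => n.
  have [s sK hs] := hK n; exists s.
    apply: le_trans sK _.
    by rewrite ler_wpM2r ?exprn_ge0 ?(ltW beta_gt0)// le_max lexx orbT.
  exists (~` `[0, 1[); split => //.
  by move=> x /= /negP xs x01; apply: xs; exact: hs.
near=> n.
have n0 : 0 < n%:R :> R by rewrite ltr0n; near: n; exists 1%N.
have upn : join_entropy (T : M -> M) nu xi n / n%:R <= ln beta + h by near: n.
have Cn : ln C <= n%:R * h.
  by rewrite -ler_pdivrMr//; near: n; exact: nbhs_infty_ger.
rewrite distrC ler_distl upn andbT ler_pdivlMr//.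
by apply: le_trans (low n); rewrite mulrBl; lra.
Unshelve. all: by end_near. Qed.

End entropy_bounds.

(** * The closure of the orbit of 0 *)

Section orbit_closure.
Context (R : realType) (alpha beta : R).
Local Notation T := (Tab alpha beta).
Local Notation M := (measurableTypeR R).
Local Notation word := (word alpha beta).

Lemma orbit0_itv01 k : 0 <= iter k T 0 < 1.
Proof.
rewrite iter_Tab_lt1// andbT.
by have /andP[] : 0 <= iter k T 0 <= 1 by apply: iter_Tab_itv01; rewrite lexx ler01.
Qed.

(** The right-hand side involves only the coding of 0, so words along this orbit can be transferred
    between maps with the same coding. *)
Lemma word_orbit0 n k :
  word n (iter k T 0) = mkseq (fun i => coding alpha beta 0 (k + i)) n.
Proof.
apply: (@eq_from_nth _ 0) => [|i]; rewrite size_word ?size_mkseq// => ni.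
rewrite nth_word// nth_mkseq// -iterD addnC /digit lt_eqF//.
by case/andP: (orbit0_itv01 (i + k)); rewrite addnC.
Qed.

Definition in_orbit0_closure (y : R) :=
  forall e, 0 < e -> exists k, `|iter k T 0 - y| < e.

(** The continuous test function to which normality is applied: it vanishes on the orbit of 0, hence
    has zero averages along it, and its zeros lie in the closure. *)
Definition orbit0_dist (y : R) : R := inf [set `|iter k T 0 - y| | k in setT].

Lemma orbit0_dist_le y k : orbit0_dist y <= `|iter k T 0 - y|.
Proof.
apply: ge_inf; last by exists k.
by exists 0 => _ [j _ <-].
Qed.

Lemma orbit0_dist_ge y c : (forall k, c <= `|iter k T 0 - y|) -> c <= orbit0_dist y.
Proof.
move=> h; apply: lb_le_inf; first by exists `|iter 0 T 0 - y|, 0%N.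
by move=> _ [k _ <-].
Qed.

Lemma orbit0_dist_ge0 y : 0 <= orbit0_dist y.
Proof. exact: orbit0_dist_ge. Qed.

Lemma orbit0_dist_lip y z : `|orbit0_dist y - orbit0_dist z| <= `|y - z|.
Proof.
wlog : y z / orbit0_dist z <= orbit0_dist y => [h|zy].
  have [/h//|/ltW/h] := leP (orbit0_dist z) (orbit0_dist y).
  by rewrite distrC [leRHS]distrC.
rewrite ger0_norm ?subr_ge0// lerBlDl -lerBlDr; apply: orbit0_dist_ge => k.
rewrite lerBlDr; apply: le_trans (orbit0_dist_le y k) _.
by rewrite [`|y - z|]distrC; exact: ler_distD.
Qed.

Lemma orbit0_dist_continuous : continuous orbit0_dist.
Proof.
move=> y; apply/cvgrPdist_lt => e e0; near=> z.
apply: le_lt_trans (orbit0_dist_lip y z) _.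
by near: z; apply: cvgr_dist_lt => //; exact: cvg_id.
Unshelve. all: by end_near. Qed.

Lemma orbit0_dist_orbit k : orbit0_dist (iter k T 0) = 0.
Proof.
apply/eqP; rewrite eq_le orbit0_dist_ge0 andbT.
by apply: le_trans (orbit0_dist_le _ k) _; rewrite subrr normr0.
Qed.

Lemma orbit0_dist_eq0 y : orbit0_dist y = 0 -> in_orbit0_closure y.
Proof.
move=> y0 e e0; apply: contrapT => h.
suff : e <= orbit0_dist y by rewrite y0 leNgt e0.
apply: orbit0_dist_ge => k; rewrite leNgt; apply/negP => ke; apply: h.
by exists k.
Qed.

Lemma normal_orbit_closure (mu : probability M R) :
    mu `[0%R, 1%R]%classic = 1%E -> normal_orbit T mu 0 ->
  mu.-negligible [set y | ~ (0 <= y <= 1 /\ in_orbit0_closure y)].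
Proof.
move=> mu01 nor.
have m01 : measurable (`[0%R, 1%R]%classic : set M) by exact: measurable_itv.
have mf : measurable_fun (`[0%R, 1%R]%classic : set M)
    (EFin \o (orbit0_dist : M -> R)).
  apply/measurable_EFinP; apply: (measurable_funS (E := setT)) => //.
  exact: (continuous_measurable_fun orbit0_dist_continuous).
have int0 : (\int[mu]_(y in `[0%R, 1%R]) (orbit0_dist y))%R = 0.
  have cont : {within `[0, 1], continuous orbit0_dist}.
    exact: continuous_subspaceT orbit0_dist_continuous.
  have := nor _ cont.
  rewrite (_ : (fun n : nat => _) = fun=> 0); last first.
    apply/funext => n; rewrite big1 ?mulr0// => i _; exact: orbit0_dist_orbit.
  by move=> /(cvg_lim (@Rhausdorff R)) <-; exact: lim_cst.
(* A real integral equal to 0 could also come from an infinite one; integrability excludes this. *)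
have intf : mu.-integrable `[0%R, 1%R] (EFin \o (orbit0_dist : M -> R)).
  apply: measurable_bounded_integrable => //.
  - exact: le_lt_trans (probability_le1 mu m01) (ltry 1).
  - exact/measurable_EFinP.
  exists 1; split => // c c1 y /=; rewrite in_itv/= => y01.
  rewrite ger0_norm ?orbit0_dist_ge0//; apply: (le_trans (orbit0_dist_le y 0)).
  by rewrite /= sub0r normrN ger0_norm; lra.
have {}int0 : (\int[mu]_(y in `[0%R, 1%R]) `|(orbit0_dist y)%:E| = 0)%E.
  under eq_integral do rewrite gee0_abs ?lee_fin ?orbit0_dist_ge0//.
  by rewrite -[LHS]fineK ?(integrable_fin_num m01 intf)//; congr (_%:E).
have /(ae_eq_integral_abs mu m01 mf) ae0 := int0.
have nout : mu.-negligible (~` `[0%R, 1%R] : set M).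
  exists (~` `[0%R, 1%R]); split => //; first exact: measurableC.
  by rewrite probability_setC// mu01 subee.
apply: negligibleS (negligibleU nout ae0).
  move=> y /= ny; apply: contrapT => /not_orP[/contrapT y01 /contrapT y0].
  apply: ny; split; first by move: y01; rewrite /= in_itv/=.
  by apply: orbit0_dist_eq0; case: (y0 y01).
Qed.

(** * Words of points in the closure *)

Hypothesis beta_gt1 : 1 < beta.

Variable s : nat -> seq (seq int).
Hypothesis orbit_s : forall n k, word n (iter k T 0) \in s n.

(** Beyond the words of the orbit, these jump at position k: the letter there is raised by one and a
    prefix of the coding of 0 follows. Only the first k + 1 letters of the left word matter, hence
    [s k.+1]. *)
Definition closure_words n : seq (seq int) :=
  s n ++ flatten [seq [seq rcons (take k v) (nth 0 v k + 1) ++ word (n - k.+1) 0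
                      | v <- s k.+1] | k <- iota 0 n].

Lemma closure_wordsP n y : 0 <= y <= 1 -> in_orbit0_closure y ->
  word n y \in closure_words n.
Proof.
move=> y01 cly; have [d d0 hr] : exists2 d, 0 < d &
    forall x, y <= x < y + d -> x < 1 -> word n x = word n y.
  have [y1|y1] := ltP y 1; last by exists 1 => // x ? ?; exfalso; lra.
  by have [d d0 hd] := word_right alpha beta_gt1 n y1; exists d => // x /hd.
rewrite mem_cat.
have [[k yk]|nr] := pselect (exists k, y <= iter k T 0 < y + d).
  by rewrite -(hr _ yk) ?orbit_s//; case/andP: (orbit0_itv01 k).
(* If no orbit point is close to y on its right, where right-continuity would settle the matter, the
   orbit accumulates at y from the left. *)
have left e : 0 < e -> exists k, y - e < iter k T 0 < y.
  move=> e0; have [|k] := cly (Num.min d e); first by rewrite lt_min d0.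
  rewrite lt_min !ltr_norml => kde; exists k.
  have [yk|yk] := leP y (iter k T 0); last lra.
  by exfalso; apply: nr; exists k; lra.
have y0 : 0 < y <= 1.
  have [k yk] := left 1 ltr01; have := orbit0_itv01 k; lra.
have [e e0 [v [hv]]] := word_left alpha beta_gt1 n y0.
have [k /hv kv] := left e e0.
have sv m : (m <= n)%N -> take m v \in s m.
  by move=> mn; rewrite -kv take_word// orbit_s.
case=> [->|[m mn ->]]; first by rewrite -[v]take_size -kv size_word kv sv.
apply/orP; right; apply/flatten_mapP; exists m; first by rewrite mem_iota.
apply/mapP; exists (take m.+1 v); first exact: sv.
by rewrite take_takel// nth_take.
Qed.

(** The jumps at positions k < n contribute a geometric series of ratio b > 1, so its sum is still
    O(b^n). *)
Lemma size_closure_words (C b : R) n : 1 < b -> 0 <= C ->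
  (forall k, (size (s k))%:R <= C * b ^+ k) ->
  (size (closure_words n))%:R <= C * (1 + b / (b - 1)) * b ^+ n.
Proof.
move=> b1 C0 sC; have bp : 0 < b - 1 by rewrite subr_gt0.
rewrite size_cat natrD mulrDr mulr1 mulrDl; apply: lerD; first exact: sC.
rewrite size_flatten /shape -map_comp sumnE big_map natr_sum.
have -> : \sum_(k <- iota 0 n) (size [seq rcons (take k v) (nth 0 v k + 1)
    ++ word (n - k.+1) 0 | v <- s k.+1])%:R = \sum_(k < n) (size (s k.+1))%:R :> R.
  rewrite -[in RHS](big_mkord xpredT (fun k => (size (s k.+1))%:R)).
  by rewrite /index_iota subn0; apply: eq_bigr => k _; rewrite size_map.
apply: (@le_trans _ _ (\sum_(k < n) C * b ^+ k.+1)); first by apply: ler_sum.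
have -> : \sum_(k < n) C * b ^+ k.+1 = C * (b / (b - 1)) * (b ^+ n - 1).
  have -> : b ^+ n - 1 = (b - 1) * \sum_(k < n) b ^+ k.
    by rewrite subrX1.
  rewrite mulrA -[C * (b / (b - 1)) * (b - 1)]mulrA divfK ?gt_eqF// mulr_sumr.
  by apply: eq_bigr => k _; rewrite exprS mulrA.
by apply: ler_wpM2l; [rewrite mulr_ge0 ?divr_ge0// ltW// (lt_trans ltr01)|lra].
Qed.

End orbit_closure.

Unset Implicit Arguments.

Theorem theorem4 (R : realType) (alpha0 beta0 : R)
    (halpha0 : 0 <= alpha0 < 1) (hbeta0 : 1 < beta0)
    (u : nat -> int) (hu : u = coding alpha0 beta0 0)
    (beta_u : R) (hbeta_u1 : 1 <= beta_u)
    (I_u : set R) (hI_u : I_u = `]beta_u, +oo[%classic \/ I_u = `[beta_u, +oo[%classic)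
    (hbeta_u : [set p : R * R |
                  0 <= p.1 < 1 /\ 1 < p.2 /\ coding p.1 p.2 0 = u]
               = [set (alpha_of u beta, beta) | beta in I_u])
    (beta : R) (hbeta : beta_u < beta)
    (mu : probability (measurableTypeR R) R)
    (hmu : max_entropy_measure (Tab (alpha_of u beta) beta) mu) :
  ~ normal_orbit (Tab (alpha_of u beta) beta) mu 0.
Proof.
have coded b : beta_u < b ->
    [/\ 0 <= alpha_of u b, 1 < b & coding (alpha_of u b) b 0 = u].
  move=> ub; have : [set (alpha_of u b, b) | b in I_u] (alpha_of u b, b).
    exists b => //; case: hI_u => ->; rewrite /= in_itv/= andbT//; exact: ltW.
  by rewrite -hbeta_u => -[/andP[/= ? _] [? ?]].
have [a0 b1 cu] := coded _ hbeta.
(* Being above beta_u keeps u as the coding of 0, being below beta makes ln b' < ln beta. *)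
pose b' := (beta_u + beta) / 2.
have [ub' b'b] : beta_u < b' /\ b' < beta by rewrite /b'; split; lra.
have [a'0 b'1 cu'] := coded _ ub'.
set alpha := alpha_of u beta in hmu a0 cu *; set alpha' := alpha_of u b' in a'0 cu'.
move=> nor.
have [C C0 hC] := few_words alpha' b'1.
pose s n := projT1 (cid2 (hC n)).
have sC n : (size (s n))%:R <= C * b' ^+ n by rewrite /s; case: cid2.
(* Such a word is a block of u, hence also a word of the map of slope b', where it has been
   counted. *)
have orbit_s n k : word alpha beta n (iter k (Tab alpha beta) 0) \in s n.
  rewrite word_orbit0 cu -cu' -word_orbit0 /s; case: cid2 => /= t _; apply.
  by rewrite /= in_itv/=; exact: orbit0_itv01.
have [mu_inv mu_max] := hmu.
have mu_le : (entropy
    (Tab alpha beta : measurableTypeR R -> measurableTypeR R) mu <= (ln b')%:E)%E.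
  apply: (entropy_le b1 mu_inv (ltW b'1)) => n.
  exists (closure_words alpha beta s n).
    exact: (size_closure_words alpha beta n b'1 (ltW C0) sC).
  apply: negligibleS (normal_orbit_closure mu_inv.1 nor) => y /= ns [y01 cly].
  by move/negP: ns; apply; exact: closure_wordsP.
have [K K0 [nu [nu_inv nuK]]] := bounded_invariant_probability alpha b1.
have := le_trans (entropy_ge b1 a0 K0 nu_inv nuK)
  (le_trans (mu_max _ nu_inv) mu_le).
by rewrite lee_fin ler_ln ?posrE ?(lt_trans ltr01)// leNgt b'b.
Qed.
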